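(* If $\hat\rho_1\in\mathcal A_1$ (i.e. $\rho_1$ is $G$-invariant), then $$S(\rho_0\,\|\,\rho_1)=S_M(\rho_0\,\|\,\rho_1)=\lim_{n\to\infty}\frac1n\sup\bigl\{S(\rho_{0,n}|_{\mathcal B}\,\|\,\rho_{1,n}|_{\mathcal B}):\ \mathcal B\text{ is an abelian subalgebra of }\mathcal A_n\bigr\}.$$
   Context: Let $\mathcal H$ be a finite-dimensional complex Hilbert space, $G$ a compact group and $g\mapsto u_g$ a continuous unitary representation of $G$ on $\mathcal H$. For $n\in\mathbb N$ let $\mathcal A_n=\{A\in\mathcal B(\mathcal H^{\otimes n}):Au_g^{\otimes n}=u_g^{\otimes n}A\ \forall g\in G\}$ and $E_{\mathcal A_n}(X)=\int_G u_g^{\otimes n}Xu_g^{*\otimes n}\,dg$ (normalized Haar measure). Let $\rho_0,\rho_1$ be states on $\mathcal B(\mathcal H)$ with density matrices $\hat\rho_0,\hat\rho_1$, and let $\rho_{k,n}$ be the state on $\mathcal B(\mathcal H^{\otimes n})$ with density $\hat\rho_{k,n}:=E_{\mathcal A_n}(\hat\rho_k^{\otimes n})$, $k=0,1$. Relative entropy: $S(\rho\|\sigma)=\operatorname{Tr}\hat\rho(\log\hat\rho-\log\hat\sigma)$ if $\operatorname{supp}\rho\le\operatorname{supp}\sigma$, $+\infty$ otherwise; for a unital *-subalgebra $\mathcal B$, $\rho|_{\mathcal B}$ denotes the restriction, and the relative entropy of restrictions is computed from their densities in $\mathcal B$ with respect to the trace (for abelian $\mathcal B$ this is the classical relative entropy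 of the probability vectors on the minimal projections of $\mathcal B$). $S_M(\rho_0\|\rho_1):=\lim_{n\to\infty}\frac1nS(\rho_{0,n}\|\rho_{1,n})$ (this limit exists). *)

(* Defs.v *)
From HB Require Import structures.
From mathcomp Require Import all_boot all_order all_algebra.
From mathcomp Require Import all_classical all_reals all_analysis.
From mathcomp Require Import complex mxtens.

Set Implicit Arguments.
Unset Strict Implicit.
Unset Printing Implicit Defensive.

Import Order.TTheory GRing.Theory Num.Theory.
Import numFieldNormedType.Exports.
Local Open Scope classical_set_scope.
Local Open Scope ring_scope.

Section QuantumDefs.
Variable R : realType.
Local Notation C := (R[i]).

Definition adjmx m n (A : 'M[C]_(m, n)) : 'M[C]_(n, m) := (map_mx Num.conj A)^T.

Definition unitarymx' n (U : 'M[C]_n) : Prop := U *m adjmx U = 1%:M.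

Definition psd n (A : 'M[C]_n) : Prop :=
  adjmx A = A /\ forall v : 'cV[C]_n, 0 <= (adjmx v *m A *m v) 0 0.

Definition density n (A : 'M[C]_n) : Prop := psd A /\ \tr A = 1.

Definition cdiag n (lam : 'rV[R]_n) : 'M[C]_n :=
  diag_mx (map_mx (fun x : R => (x +i* 0)%C) lam).

(* Matrix logarithm of a positive semidefinite matrix, via a spectral
   decomposition A = U diag(lam) U^*, log A := U diag(ln lam) U^*;
   with the convention log 0 := 0 this is the logarithm on the support
   (the usual convention in  Tr rho log rho, 0 log 0 = 0).  The value does
   not depend on the chosen spectral decomposition. *)
Definition mxlog n (A : 'M[C]_n) : 'M[C]_n :=
  xget 0 [set L | exists (U : 'M[C]_n) (lam : 'rV[R]_n),
     [/\ unitarymx' U, A = U *m cdiag lam *m adjmx U &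
         L = U *m cdiag (map_mx (fun x : R => if 0 < x then ln x else 0) lam) *m adjmx U]].

Definition supp_le n (rho sigma : 'M[C]_n) : Prop :=
  forall v : 'cV[C]_n, sigma *m v = 0 -> rho *m v = 0.

Definition relent n (rho sigma : 'M[C]_n) : \bar R :=
  if `[< supp_le rho sigma >]
  then (complex.Re (\tr (rho *m (mxlog rho - mxlog sigma))))%:E
  else +oo%E.

Fixpoint tpow d (A : 'M[C]_d) (n : nat) : 'M[C]_(d ^ n) :=
  match n return 'M[C]_(d ^ n) with
  | 0 => castmx (esym (expn0 d), esym (expn0 d)) (1%:M : 'M[C]_1)
  | n'.+1 => castmx (esym (expnS d n'), esym (expnS d n')) (A *t tpow A n')
  end.

Definition cintegral dT (T : measurableType dT) (mu : {measure set T -> \bar R})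
  (f : T -> C) : C :=
  ((\int[mu]_x complex.Re (f x))%R +i* (\int[mu]_x complex.Im (f x))%R)%C.

Record compact_group (G : ptopologicalType) (mul : G -> G -> G) (inv : G -> G)
    (e : G) : Prop := {
  cg_assoc : forall x y z, mul x (mul y z) = mul (mul x y) z;
  cg_unit : forall x, mul e x = x /\ mul x e = x;
  cg_inv : forall x, mul (inv x) x = e /\ mul x (inv x) = e;
  cg_mul_cont : continuous (fun p : G * G => mul p.1 p.2);
  cg_inv_cont : continuous inv;
  cg_compact : compact [set: G];
  cg_hausdorff : hausdorff_space G }.

Definition borelG (G : ptopologicalType) := g_sigma_algebraType (@open G).

Definition haar_prob (G : ptopologicalType) (mul : G -> G -> G)
    (mu : {measure set borelG G -> \bar R}) : Prop :=
  mu [set: borelG G] = 1%E /\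
  forall (g : G) (A : set (borelG G)), measurable A ->
    mu [set mul g x | x in A] = mu A.

Definition cont_unitary_rep (G : ptopologicalType) (mul : G -> G -> G) (e : G)
    d (u : G -> 'M[C]_d) : Prop :=
  [/\ forall g, unitarymx' (u g),
      u e = 1%:M,
      forall g h, u (mul g h) = u g *m u h &
      forall i j, continuous (fun g => complex.Re (u g i j)) /\
                  continuous (fun g => complex.Im (u g i j))].

Definition commutant (G : ptopologicalType) d (u : G -> 'M[C]_d) (n : nat) :
    set 'M[C]_(d ^ n) :=
  [set A | forall g, A *m tpow (u g) n = tpow (u g) n *m A].

Definition twirl (G : ptopologicalType) (mu : {measure set borelG G -> \bar R})
    d (u : G -> 'M[C]_d) (n : nat) (X : 'M[C]_(d ^ n)) : 'M[C]_(d ^ n) :=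
  \matrix_(i, j) cintegral mu
     (fun g : borelG G => (tpow (u g) n *m X *m adjmx (tpow (u g) n)) i j).

Definition star_subalg N (B : set 'M[C]_N) : Prop :=
  [/\ B 1%:M,
      forall (a : C) x y, B x -> B y -> B (a *: x + y),
      forall x y, B x -> B y -> B (x *m y) &
      forall x, B x -> B (adjmx x)].

Definition abelian_subalg_of N (A : set 'M[C]_N) (B : set 'M[C]_N) : Prop :=
  [/\ star_subalg B, B `<=` A & forall x y, B x -> B y -> x *m y = y *m x].

(* density of the restriction rho|_B with respect to the trace:
   the D in B with Tr(D b) = Tr(rho b) for every b in B *)
Definition restr_density N (B : set 'M[C]_N) (rho : 'M[C]_N) : 'M[C]_N :=
  xget 0 [set D | B D /\ forall b, B b -> \tr (D *m b) = \tr (rho *m b)].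

Definition relent_restr N (B : set 'M[C]_N) (rho sigma : 'M[C]_N) : \bar R :=
  relent (restr_density B rho) (restr_density B sigma).

End QuantumDefs.

Arguments commutant {R G d} u n _.

(* Main.v *)
(** The twirled states are the densities of the restrictions of the product
states [r] and [s] to the commutant, and [s] is already invariant. So the upper
bounds are the monotonicity of relative entropy under restriction to a
*-subalgebra [B]. Writing the entropy as an integral over [t > 0], monotonicity
reduces to the variational formula
[2 Re Tr r X - Tr s X X^* - t Tr r X^* X <= sum_ij w_ij p_i^2 / (q_j + t p_i)],
whose left-hand side depends only on the restrictions when [X] is in [B], and
whose maximizer for the restricted densities lies in [B].

For the lower bounds, let [V] be the span of all tensor powers [A^(tensor n)].
Its dimension is at most [(n + 1)^(d^2)], and [M := sum_k f_k f_k^*], for an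
orthonormal basis [f] of [V], commutes with all tensor powers and dominates [r].
Hence [r <= K T] for an invertible invariant state [T] and a polynomial [K], so
[S(r || T) <= ln K]. A state [X] that agrees with [r] on [log T] and [log s]
satisfies [S(X || s) = S(X || T) + S(r || s) - S(r || T) >= S(r || s) - ln K].
This applies to the twirl of [r], and also to its restriction to the abelian
algebra given by the bicommutant of [T] and [s]. *)

Require Import Defs.
From HB Require Import structures.
From mathcomp Require Import all_boot all_order all_algebra.
From mathcomp Require Import all_classical all_reals all_analysis.
From mathcomp Require Import complex mxtens spectral sesquilinear measurable_realfun ring lra.
Set Implicit Arguments.
Unset Strict Implicit.
Unset Printing Implicit Defensive.
Import Order.TTheory GRing.Theory Num.Theory.
Import numFieldNormedType.Exports.
Local Open Scope classical_set_scope.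
Local Open Scope ring_scope.

(** * Adjoints, and spectral decompositions of Hermitian and positive matrices *)

Section Adjoint.
Variable R : realType.
Local Notation C := (R[i]).
Local Notation r2c := (real_complex R).

Definition sqn (z : C) : R := complex.Re z ^+ 2 + complex.Im z ^+ 2.

Lemma sqn_ge0 z : 0 <= sqn z.
Proof. by rewrite addr_ge0 ?sqr_ge0. Qed.

Lemma mul_conjC_sqn (z : C) : z * Num.conj z = r2c (sqn z).
Proof. by rewrite -normCK -add_Re2_Im2. Qed.

Lemma sqn_eq0 (z : C) : (sqn z == 0) = (z == 0).
Proof. by rewrite -(inj_eq (@complexI R)) -mul_conjC_sqn mul_conjC_eq0. Qed.

Lemma conj_r2c (x : R) : Num.conj (r2c x) = r2c x.
Proof. exact: conjc_real. Qed.

Lemma ReC_r2c (x : R) : complex.Re (r2c x) = x. Proof. by []. Qed.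

Lemma ReC_conj (z : C) : complex.Re (Num.conj z) = complex.Re z.
Proof. by case: z. Qed.

Lemma ReC_mul_r2c (x : R) (z : C) : complex.Re (r2c x * z) = x * complex.Re z.
Proof. by case: z => a b /=; rewrite mul0r subr0. Qed.

Lemma ReCD (x y : C) : complex.Re (x + y) = complex.Re x + complex.Re y.
Proof. by case: x; case: y. Qed.

Lemma ReCB (x y : C) : complex.Re (x - y) = complex.Re x - complex.Re y.
Proof. by case: x; case: y. Qed.

Lemma ReC_sum I (s : seq I) (P : pred I) (F : I -> C) :
  complex.Re (\sum_(i <- s | P i) F i) = \sum_(i <- s | P i) complex.Re (F i).
Proof. exact: (big_morph _ ReCD). Qed.

Lemma r2c_sum I (s : seq I) (P : pred I) (F : I -> R) :
  r2c (\sum_(i <- s | P i) F i) = \sum_(i <- s | P i) r2c (F i).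
Proof. exact: rmorph_sum. Qed.

Lemma sqnM (x y : C) : sqn (x * y) = sqn x * sqn y.
Proof. by case: x => a b; case: y => c d; rewrite /sqn /=; ring. Qed.

Lemma sqn_conj (x : C) : sqn (Num.conj x) = sqn x.
Proof. by case: x => a b; rewrite /sqn /= sqrrN. Qed.

Lemma adjmxE m n (A : 'M[C]_(m, n)) i j : adjmx A i j = Num.conj (A j i).
Proof. by rewrite !mxE. Qed.

Lemma adjmxK m n (A : 'M[C]_(m, n)) : adjmx (adjmx A) = A.
Proof. by apply/matrixP => i j; rewrite !adjmxE conjCK. Qed.

Lemma adjmxM m n p (A : 'M[C]_(m, n)) (B : 'M[C]_(n, p)) :
  adjmx (A *m B) = adjmx B *m adjmx A.
Proof. by rewrite /adjmx map_mxM trmx_mul. Qed.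

Lemma adjmxB m n (A B : 'M[C]_(m, n)) : adjmx (A - B) = adjmx A - adjmx B.
Proof. by rewrite /adjmx map_mxB raddfB. Qed.

Lemma adjmxZ m n a (A : 'M[C]_(m, n)) : adjmx (a *: A) = Num.conj a *: adjmx A.
Proof. by apply/matrixP => i j; rewrite !mxE rmorphM. Qed.

Lemma adjmx1 n : adjmx (1%:M : 'M[C]_n) = 1%:M.
Proof. by rewrite /adjmx map_mx1 trmx1. Qed.

Lemma adjmx_sum m n I (s : seq I) (P : pred I) (F : I -> 'M[C]_(m, n)) :
  adjmx (\sum_(i <- s | P i) F i) = \sum_(i <- s | P i) adjmx (F i).
Proof.
by rewrite /adjmx raddf_sum raddf_sum.
Qed.

Lemma tr_adjmx n (A : 'M[C]_n) : \tr (adjmx A) = Num.conj (\tr A).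
Proof. by rewrite rmorph_sum; apply: eq_bigr => i _; rewrite adjmxE. Qed.

Lemma tr_mul_adjmx m n (A : 'M[C]_(m, n)) :
  \tr (A *m adjmx A) = r2c (\sum_i \sum_j sqn (A i j)).
Proof.
rewrite r2c_sum; apply: eq_bigr => i _; rewrite mxE r2c_sum.
by apply: eq_bigr => j _; rewrite adjmxE mul_conjC_sqn.
Qed.

Lemma tr_mul_adjmx_eq0 m n (A : 'M[C]_(m, n)) : \tr (A *m adjmx A) = 0 -> A = 0.
Proof.
rewrite tr_mul_adjmx => /(congr1 (@complex.Re R)); rewrite ReC_r2c /= => /eqP.
rewrite psumr_eq0 => [/allP h|i _]; last first.
  by apply: sumr_ge0 => j _; exact: sqn_ge0.
apply/matrixP => i j; rewrite mxE.
have := h i; rewrite mem_index_enum => /(_ isT) /=.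
rewrite psumr_eq0 => [/allP /(_ j)|k _]; last exact: sqn_ge0.
by rewrite mem_index_enum => /(_ isT) /=; rewrite sqn_eq0 => /eqP.
Qed.

Lemma unitarymx_adj n (U : 'M[C]_n) : unitarymx' U -> adjmx U *m U = 1%:M.
Proof. exact: mulmx1C. Qed.

Lemma unitarymx_adjmx n (U : 'M[C]_n) : unitarymx' U -> unitarymx' (adjmx U).
Proof. by move=> h; rewrite /unitarymx' adjmxK; exact: unitarymx_adj. Qed.

Lemma unitarymxM n (U V : 'M[C]_n) : unitarymx' U -> unitarymx' V ->
  unitarymx' (U *m V).
Proof.
move=> hU hV; rewrite /unitarymx' adjmxM mulmxA -(mulmxA U V).
by rewrite (hV : V *m _ = _) mulmx1.
Qed.

Lemma unitary_row_sum n (U : 'M[C]_n) i : unitarymx' U -> \sum_j sqn (U i j) = 1.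
Proof.
move=> /matrixP /(_ i i); rewrite !mxE eqxx => h; apply: (@complexI R).
by rewrite r2c_sum -[RHS]h; apply: eq_bigr => j _; rewrite adjmxE mul_conjC_sqn.
Qed.

Lemma unitary_col_sum n (U : 'M[C]_n) j : unitarymx' U -> \sum_i sqn (U i j) = 1.
Proof.
move=> /unitarymx_adjmx /(unitary_row_sum j) <-.
by apply: eq_bigr => i _; rewrite adjmxE sqn_conj.
Qed.

Lemma cdiagE n (p : 'rV[R]_n) i j : cdiag p i j = r2c (p 0 i) *+ (i == j).
Proof. by rewrite !mxE. Qed.

Lemma mul_cdiag m n (p : 'rV[R]_m) (A : 'M[C]_(m, n)) i j :
  (cdiag p *m A) i j = r2c (p 0 i) * A i j.
Proof. by rewrite mul_diag_mx !mxE. Qed.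

Lemma mul_mx_cdiag m n (q : 'rV[R]_n) (A : 'M[C]_(m, n)) i j :
  (A *m cdiag q) i j = A i j * r2c (q 0 j).
Proof. by rewrite mul_mx_diag !mxE. Qed.

Lemma adjmx_cdiag n (p : 'rV[R]_n) : adjmx (cdiag p) = cdiag p.
Proof.
apply/matrixP => i j; rewrite adjmxE !cdiagE eq_sym.
by case: eqP => [->|]; rewrite ?mulr1n ?conj_r2c ?mulr0n ?rmorph0.
Qed.

Definition spec n (U : 'M[C]_n) (p : 'rV[R]_n) : 'M[C]_n :=
  U *m cdiag p *m adjmx U.

Lemma adjmx_spec n (U : 'M[C]_n) p : adjmx (spec U p) = spec U p.
Proof. by rewrite /spec !adjmxM adjmxK adjmx_cdiag mulmxA. Qed.

Lemma specD n (U : 'M[C]_n) p q : spec U (p + q) = spec U p + spec U q.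
Proof.
rewrite /spec -mulmxDl -mulmxDr; congr (_ *m _ *m _).
apply/matrixP => i j; rewrite [RHS]mxE !cdiagE mxE.
by rewrite rmorphD mulrnDl.
Qed.

Lemma specZ n (U : 'M[C]_n) a p : spec U (a *: p) = r2c a *: spec U p.
Proof.
rewrite /spec scalemxAl scalemxAr; congr (_ *m _ *m _).
apply/matrixP => i j; rewrite [RHS]mxE !cdiagE mxE.
by rewrite rmorphM mulrnAr.
Qed.

Lemma spec_const1 n (U : 'M[C]_n) : unitarymx' U -> spec U (const_mx 1) = 1%:M.
Proof.
move=> hU; rewrite /spec (_ : cdiag _ = 1%:M) ?mulmx1 //.
by apply/matrixP => i j; rewrite cdiagE !mxE.
Qed.

Lemma specM n (U : 'M[C]_n) p q : unitarymx' U ->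
  spec U p *m spec U q = spec U (\row_i (p 0 i * q 0 i)).
Proof.
move=> hU; rewrite /spec !mulmxA -(mulmxA _ (adjmx U) U) unitarymx_adj // mulmx1.
congr (_ *m _); rewrite -mulmxA; congr (_ *m _).
apply/matrixP => i j; rewrite mul_cdiag !cdiagE mxE.
by rewrite rmorphM mulrnAr.
Qed.

(** In the eigenbases the hypothesis reads [p 0 i * Y i j = Y i j * q 0 j], so [p] and [q] agree
    wherever [Y] has a nonzero entry, and then so do their images under [f]. For [Z = 1] this shows
    that a function of a matrix does not depend on the chosen decomposition. *)
Lemma spec_intertwine n (U V Z : 'M[C]_n) p q (f : R -> R) :
  unitarymx' U -> unitarymx' V ->
  spec U p *m Z = Z *m spec V q ->
  spec U (map_mx f p) *m Z = Z *m spec V (map_mx f q).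
Proof.
move=> hU hV h.
have key p' q' : (spec U p' *m Z = Z *m spec V q') <->
    (cdiag p' *m (adjmx U *m Z *m V) = (adjmx U *m Z *m V) *m cdiag q').
  rewrite /spec; split=> e.
    have := congr1 (fun X => adjmx U *m X *m V) e; rewrite !mulmxA.
    rewrite (unitarymx_adj hU) mul1mx => ->.
    by rewrite -(mulmxA _ (adjmx V) V) (unitarymx_adj hV) mulmx1.
  have := congr1 (fun X => U *m X *m adjmx V) e; rewrite !mulmxA.
  rewrite (hU : U *m _ = _) mul1mx => <-.
  by rewrite -(mulmxA _ V (adjmx V)) (hV : V *m _ = _) mulmx1.
apply/key; move/key: h; set Y := _ *m _ *m V => /matrixP h.
apply/matrixP => i j; have := h i j; rewrite !mul_cdiag !mul_mx_cdiag ![map_mx _ _ _ _]mxE.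
have [->|w0] := eqVneq (Y i j) 0; first by rewrite !mulr0 !mul0r.
by rewrite mulrC => /(mulfI w0)/complexI ->; rewrite mulrC.
Qed.

(** Shaped like [mxlog], so that [mxlog] is the case of [lnp] by conversion. *)
Definition mxfun (f : R -> R) n (A : 'M[C]_n) : 'M[C]_n :=
  xget 0 [set L | exists (U : 'M[C]_n) (lam : 'rV[R]_n),
     [/\ unitarymx' U, A = spec U lam & L = spec U (map_mx f lam)]].

Definition lnp (x : R) : R := if 0 < x then ln x else 0.

Lemma mxlogE n (A : 'M[C]_n) : mxlog A = mxfun lnp A.
Proof. by []. Qed.

Lemma mxfun_spec f n (U : 'M[C]_n) p : unitarymx' U ->
  mxfun f (spec U p) = spec U (map_mx f p).
Proof.
move=> hU; rewrite /mxfun; case: xgetP => [L _ [V [q [hV e ->]]]|/(_ (spec U (map_mx f p)))].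
  have /(@spec_intertwine n V U 1%:M q p f hV hU) : spec V q *m 1%:M = 1%:M *m spec U p.
    by rewrite mulmx1 mul1mx e.
  by rewrite mulmx1 mul1mx.
by case; exists U, p.
Qed.

Lemma hermitian_spec n (A : 'M[C]_n) : adjmx A = A ->
  exists U p, unitarymx' U /\ A = spec U p.
Proof.
move=> hA.
have hh : A \is hermsymmx.
  apply/is_hermitianmxP; rewrite expr0 scale1r -[LHS]hA.
  by apply/matrixP => i j; rewrite !mxE.
have /orthomx_spectralP e := hermitian_normalmx hh.
have hr := hermitian_spectral_diag_real hh.
have hU := spectral_unitarymx A.
exists (adjmx (spectralmx A)), (map_mx (@complex.Re R) (spectral_diag A)).
have adjE m k (B : 'M[C]_(m, k)) : adjmx B = (B^T ^ Num.conj)%sesqui.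
  by apply/matrixP => i j; rewrite !mxE.
have hU' : unitarymx' (spectralmx A).
  by apply/eqP; rewrite adjE; move: hU; rewrite qualifE.
split; first exact: unitarymx_adjmx.
rewrite {1}e invmx_unitary // /spec adjmxK -adjE; congr (_ *m _ *m _).
apply/matrixP => i j; rewrite cdiagE !mxE.
move/mxOverP: hr => /(_ 0 i) /complex_realP [x ->].
by rewrite ReC_r2c.
Qed.

Lemma quad_spec n (U : 'M[C]_n) p (v : 'cV[C]_n) :
  (adjmx v *m spec U p *m v) 0 0 = r2c (\sum_i p 0 i * sqn ((adjmx U *m v) i 0)).
Proof.
have -> : adjmx v *m spec U p *m v =
    adjmx (adjmx U *m v) *m cdiag p *m (adjmx U *m v).
  by rewrite adjmxM adjmxK /spec !mulmxA.
rewrite mxE r2c_sum; apply: eq_bigr => i _.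
rewrite mul_mx_cdiag adjmxE mulrAC [Num.conj _ * _]mulrC mul_conjC_sqn.
by rewrite rmorphM mulrC.
Qed.

Lemma psd_spec n (A : 'M[C]_n) : psd A ->
  exists U p, [/\ unitarymx' U, A = spec U p & forall i, 0 <= p 0 i].
Proof.
case=> hA hp; have [U [p [hU e]]] := hermitian_spec hA; exists U, p; split=> // i.
have := hp (U *m delta_mx i 0); rewrite e quad_spec mulmxA unitarymx_adj // mul1mx.
rewrite ler0c (bigD1 i) //= big1 => [|j ji].
  by rewrite !mxE !eqxx /sqn /= expr1n expr0n addr0 addr0 mulr1.
by rewrite mxE (negbTE ji) /= /sqn /= expr0n addr0 mulr0.
Qed.

Lemma spec_psd n (U : 'M[C]_n) (p : 'rV[R]_n) : (forall i, 0 <= p 0 i) -> psd (spec U p).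
Proof.
move=> hp; split=> [|v]; first exact: adjmx_spec.
by rewrite quad_spec ler0c sumr_ge0 // => i _; rewrite mulr_ge0 ?sqn_ge0.
Qed.

Lemma tr_specM n (U V : 'M[C]_n) p q :
  \tr (spec U p *m spec V q) =
  r2c (\sum_i \sum_j sqn ((adjmx U *m V) i j) * (p 0 i * q 0 j)).
Proof.
have -> : \tr (spec U p *m spec V q) =
    \tr (cdiag p *m (adjmx U *m V) *m (cdiag q *m adjmx (adjmx U *m V))).
  rewrite adjmxM adjmxK /spec -(mulmxA U) -(mulmxA U) mxtrace_mulC.
  by rewrite !mulmxA.
rewrite r2c_sum /mxtrace; apply: eq_bigr => i _; rewrite mxE r2c_sum.
apply: eq_bigr => j _; rewrite !mul_cdiag adjmxE !rmorphM /= -mul_conjC_sqn.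
by ring.
Qed.

Lemma tr_spec n (U : 'M[C]_n) p : unitarymx' U -> \tr (spec U p) = r2c (\sum_i p 0 i).
Proof.
move=> hU; rewrite /spec mxtrace_mulC mulmxA unitarymx_adj // mul1mx r2c_sum.
by apply: eq_bigr => i _; rewrite cdiagE eqxx.
Qed.

End Adjoint.

(** * Functional calculus inside a matrix algebra; entropy and supports in spectral coordinates *)

Section FunctionalCalculus.
Variable R : realType.
Local Notation C := (R[i]).
Local Notation r2c := (real_complex R).

Definition lin_closed (V : lmodType C) (B : set V) : Prop :=
  B 0 /\ forall (a : C) x y, B x -> B y -> B (a *: x + y).

Lemma lin_closedZ (V : lmodType C) (B : set V) a x :
  lin_closed B -> B x -> B (a *: x).
Proof. by move=> [h0 h] hx; rewrite -[_ *: _]addr0; exact: h. Qed.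

Lemma lin_closed_sum (V : lmodType C) (B : set V) I (s : seq I) (P : pred I)
    (a : I -> C) (F : I -> V) :
  lin_closed B -> (forall i, P i -> B (F i)) -> B (\sum_(i <- s | P i) a i *: F i).
Proof.
move=> [h0 h] hF; elim/big_rec: _ => [|i x Pi hx]; first exact: h0.
by apply: h => //; exact: hF.
Qed.

Definition mxalg n (B : set 'M[C]_n) : Prop :=
  [/\ B 1%:M, forall (a : C) x y, B x -> B y -> B (a *: x + y) &
      forall x y, B x -> B y -> B (x *m y)].

Lemma star_subalg_mxalg n (B : set 'M[C]_n) : star_subalg B -> mxalg B.
Proof. by case. Qed.

Lemma mxalg_lin n (B : set 'M[C]_n) : mxalg B -> lin_closed B.
Proof.
move=> [h1 h _]; split=> //.
by rewrite -[0](subrr 1%:M) addrC -scaleN1r; exact: h.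
Qed.

(** On the finite spectrum the indicator of [x] is a Lagrange interpolation polynomial, with the
    eigenvalues other than [x] as nodes; the spectral projection is thus a polynomial in the
    matrix. *)
Lemma mxalg_delta n (B : set 'M[C]_n) (U : 'M[C]_n) (p : 'rV[R]_n) (x : R) :
  mxalg B -> unitarymx' U -> B (spec U p) ->
  B (spec U (map_mx (fun y => (y == x)%:R) p)).
Proof.
move=> hB hU hp; have hL := mxalg_lin hB; case: (hB) => h1 hlin hM.
have step s : B (spec U (map_mx (fun y => \prod_(z <- s) ((y - z) / (x - z))) p)).
  elim: s => [|z s IH].
    rewrite (_ : map_mx _ p = const_mx 1) ?spec_const1 //.
    by apply/matrixP => i j; rewrite !mxE big_nil.
  rewrite (_ : map_mx _ p = \row_i
    (((x - z)^-1 *: p + (- z / (x - z)) *: const_mx 1) 0 i *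
     (map_mx (fun y => \prod_(z <- s) ((y - z) / (x - z))) p) 0 i)); last first.
    by apply/matrixP => i j; rewrite !mxE big_cons ord1; congr (_ * _); ring.
  rewrite -specM //; apply: hM => //.
  rewrite specD !specZ spec_const1 //; apply: hlin => //.
  exact: lin_closedZ.
have := step [seq p 0 j | j <- enum 'I_n & p 0 j != x].
congr (B (spec U _)); apply/matrixP => i j; rewrite !mxE ord1 {i}.
rewrite big_map big_filter; case: (eqVneq (p 0 j) x) => [->|neq].
  rewrite big1_seq // => k /andP[hk _]; rewrite divff // subr_eq0 eq_sym //.
apply/eqP; rewrite prodf_seq_eq0; apply/hasP; exists j; first by rewrite mem_enum.
by rewrite neq subrr mul0r eqxx.
Qed.

(** A sum over indices meets each eigenvalue as often as its multiplicity; dividing by the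
    multiplicity makes it a sum over distinct eigenvalues. *)
Lemma level_sum n (p : 'rV[R]_n) (h : R -> R) k :
  \sum_i (p 0 k == p 0 i)%:R * (h (p 0 i) / \sum_j (p 0 j == p 0 i)%:R) = h (p 0 k).
Proof.
pose m := \sum_j (p 0 j == p 0 k)%:R : R.
have m0 : m != 0.
  rewrite /m (bigD1 k) //= eqxx gt_eqF // ltr_wpDr ?ltr01 //.
  by apply: sumr_ge0 => j _; rewrite ler0n.
under eq_bigr => i _.
  rewrite (_ : _ * _ = (p 0 i == p 0 k)%:R * (h (p 0 k) / m)); last first.
    rewrite eq_sym; case: eqP => [e|]; last by rewrite !mul0r.
    by rewrite /m -e.
  over.
by rewrite -mulr_suml -/m mulrCA divff // mulr1.
Qed.

(** The matrix is the sum of [g b a] times [Q_b P_a] over the eigenvalues, where [P_a] and [Q_b] are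
    the spectral projections of [spec U p] and [spec V q], which lie in [B] by [mxalg_delta]. This
    function of two possibly noncommuting matrices has the form of the maximizer in [qform_max]. *)
Lemma mxalg_fun2 n (B : set 'M[C]_n) (U V : 'M[C]_n) (p q : 'rV[R]_n)
    (g : R -> R -> R) :
  mxalg B -> unitarymx' U -> unitarymx' V -> B (spec U p) -> B (spec V q) ->
  B (V *m (\matrix_(j, i) (r2c (g (q 0 j) (p 0 i)) * (adjmx V *m U) j i))
     *m adjmx U).
Proof.
move=> hB hU hV hp hq; have hL := mxalg_lin hB; case: (hB) => h1 hlin hM.
pose m (p : 'rV[R]_n) i := \sum_j (p 0 j == p 0 i)%:R : R.
pose dl (p : 'rV[R]_n) i := map_mx (fun y => (y == p 0 i)%:R) p : 'rV[R]_n.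
rewrite (_ : _ *m _ = \sum_i \sum_j r2c (g (q 0 j) (p 0 i) / m q j / m p i) *:
   (spec V (dl q j) *m spec U (dl p i))).
  apply: (big_ind B); first by case: hL.
    by move=> x y hx hy; rewrite -[x]scale1r; exact: hlin.
  move=> i _; apply: lin_closed_sum => // j _; apply: hM; exact: mxalg_delta.
have e i j : spec V (dl q j) *m spec U (dl p i) =
    V *m (cdiag (dl q j) *m (adjmx V *m U) *m cdiag (dl p i)) *m adjmx U.
  by rewrite /spec !mulmxA.
under [RHS]eq_bigr => i _.
  under eq_bigr => j _ do rewrite e scalemxAl scalemxAr.
  rewrite -mulmx_suml -mulmx_sumr; over.
rewrite -mulmx_suml -mulmx_sumr; congr (_ *m _ *m _).
apply/matrixP => k l; rewrite mxE summxE.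
under eq_bigr => i _.
  rewrite summxE.
  under eq_bigr => j _.
    have -> : (r2c (g (q 0 j) (p 0 i) / m q j / m p i) *:
        (cdiag (dl q j) *m (adjmx V *m U) *m cdiag (dl p i))) k l =
        r2c ((p 0 l == p 0 i)%:R * ((q 0 k == q 0 j)%:R *
          (g (q 0 j) (p 0 i) / m q j)) / m p i) * (adjmx V *m U) k l.
      rewrite mxE mul_mx_cdiag mul_cdiag [dl q j _ _]mxE [dl p i _ _]mxE.
      by rewrite !rmorphM /=; ring.
    over.
  rewrite -mulr_suml -r2c_sum -mulr_suml -mulr_sumr (level_sum q (g^~ (p 0 i))).
  rewrite -mulrA; over.
by rewrite -mulr_suml -r2c_sum (level_sum p (g (q 0 k))).
Qed.

Lemma mxalg_spec n (B : set 'M[C]_n) (U : 'M[C]_n) (p : 'rV[R]_n) (f : R -> R) :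
  mxalg B -> unitarymx' U -> B (spec U p) -> B (spec U (map_mx f p)).
Proof.
move=> hB hU hp; have := mxalg_fun2 (fun=> f) hB hU hU hp hp.
congr (B (_ *m _ *m _)); apply/matrixP => i j.
rewrite unitarymx_adj // cdiagE !mxE.
by case: eqP => [->|]; rewrite ?mulr1 ?mulr0.
Qed.

Lemma mxalg_mxfun n (B : set 'M[C]_n) (A : 'M[C]_n) (f : R -> R) :
  mxalg B -> adjmx A = A -> B A -> B (mxfun f A).
Proof.
move=> hB /hermitian_spec [U [p [hU ->]]] hA.
by rewrite mxfun_spec //; exact: mxalg_spec.
Qed.

(** Squared overlaps of two eigenbases. For unitaries they form a doubly stochastic matrix, which
    turns the relative entropy into a sum over pairs of eigenvalues. *)
Definition weight n (U V : 'M[C]_n) i j : R := sqn ((adjmx U *m V) i j).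

Lemma weight_ge0 n (U V : 'M[C]_n) i j : 0 <= weight U V i j.
Proof. exact: sqn_ge0. Qed.

Lemma weight_row n (U V : 'M[C]_n) i : unitarymx' U -> unitarymx' V ->
  \sum_j weight U V i j = 1.
Proof.
by move=> hU hV; apply: unitary_row_sum; apply: unitarymxM => //;
  exact: unitarymx_adjmx.
Qed.

Lemma weight_col n (U V : 'M[C]_n) j : unitarymx' U -> unitarymx' V ->
  \sum_i weight U V i j = 1.
Proof.
by move=> hU hV; apply: unitary_col_sum; apply: unitarymxM => //;
  exact: unitarymx_adjmx.
Qed.

Definition trent n (A B : 'M[C]_n) : R :=
  complex.Re (\tr (A *m (mxlog A - mxlog B))).

Lemma trentE n (U V : 'M[C]_n) (p q : 'rV[R]_n) : unitarymx' U -> unitarymx' V ->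
  trent (spec U p) (spec V q) =
  \sum_i \sum_j weight U V i j * (p 0 i * (lnp (p 0 i) - lnp (q 0 j))).
Proof.
move=> hU hV; rewrite /trent mulmxBr linearB ReCB !mxlogE !mxfun_spec //=.
rewrite specM // tr_spec // tr_specM !ReC_r2c -sumrB; apply: eq_bigr => i _.
rewrite !mxE -[X in X - _]mul1r -(weight_row i hU hV) mulr_suml -sumrB.
by apply: eq_bigr => j _; rewrite [map_mx _ _ _ _]mxE /weight; ring.
Qed.

Definition kerproj n (A : 'M[C]_n) := mxfun (fun x => (x == 0)%:R) A.

Lemma supp_le_spec n (U V : 'M[C]_n) (p q : 'rV[R]_n) :
  unitarymx' U -> unitarymx' V ->
  supp_le (spec U p) (spec V q) <->
  (forall i j, q 0 j = 0 -> p 0 i != 0 -> weight U V i j = 0).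
Proof.
move=> hU hV; split=> [h i j qj pi|h v].
  have e0 : spec V q *m (V *m (delta_mx j 0 : 'cV[C]_n)) = 0.
    rewrite /spec mulmxA -(mulmxA _ _ V) unitarymx_adj // mulmx1 -mulmxA.
    rewrite (_ : cdiag _ *m _ = 0) ?mulmx0 //.
    apply/matrixP => k l; rewrite mul_cdiag !mxE.
    by case: eqP => [->|]; rewrite ?mulr0 // qj mul0r.
  have /(congr1 (mulmx (adjmx U))) := h _ e0; rewrite /spec !mulmxA unitarymx_adj // mul1mx.
  rewrite mulmx0 -!mulmxA (mulmxA (adjmx U)) => /matrixP /(_ i 0).
  rewrite mul_cdiag -colE !mxE => /eqP; rewrite mulf_eq0.
  rewrite (inj_eq (@complexI R) _ 0) (negbTE pi) /= => /eqP e.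
  by apply/eqP; rewrite sqn_eq0 mxE e.
move/(congr1 (mulmx (adjmx V))); rewrite /spec !mulmxA unitarymx_adj // mul1mx.
rewrite mulmx0 -!mulmxA => e.
rewrite -[v]mul1mx -(hV : V *m _ = _) -mulmxA.
set y := adjmx V *m v in e *.
rewrite (_ : cdiag p *m _ = 0) ?mulmx0 //; apply/matrixP => i k.
rewrite mul_cdiag [RHS]mxE mulmxA mxE mulr_sumr big1 // => j _.
have [-> |pi] := eqVneq (p 0 i) 0; first by rewrite mul0r.
have /matrixP /(_ j k) /eqP := e; rewrite mul_cdiag [X in _ == X]mxE mulf_eq0 => /orP[|/eqP->].
  rewrite (inj_eq (@complexI R) _ 0) => /eqP qj.
  by have /eqP := h i j qj pi; rewrite sqn_eq0 => /eqP ->; rewrite mul0r mulr0.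
by rewrite !mulr0.
Qed.

(** All terms of the trace are nonnegative, so it vanishes only if each of them does. In this form
    the support condition passes to restrictions, since the projection lies in every matrix algebra
    that contains the matrix [B]. *)
Lemma supp_le_kerproj n (A B : 'M[C]_n) : psd A -> adjmx B = B ->
  supp_le A B <-> \tr (A *m kerproj B) = 0.
Proof.
move=> /psd_spec [U [p [hU -> hp]]] /hermitian_spec [V [q [hV ->]]].
rewrite supp_le_spec // /kerproj mxfun_spec // tr_specM.
have t0 i j : 0 <= weight U V i j * (p 0 i * (map_mx (fun x => (x == 0)%:R) q) 0 j).
  by rewrite !mulr_ge0 ?weight_ge0 // mxE ler0n.
split=> [h|/complexI /eqP].
  rewrite big1 // => i _; rewrite big1 // => j _; rewrite [map_mx _ _ _ _]mxE.
  case: (eqVneq (q 0 j) 0) => [qj|_]; last by rewrite !mulr0.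
  have [->|pi] := eqVneq (p 0 i) 0; first by rewrite mul0r mulr0.
  by rewrite -/(weight U V i j) h // mul0r.
rewrite psumr_eq0 => [/allP h i j qj pi|i _]; last by apply: sumr_ge0 => j _; exact: t0.
have := h i; rewrite mem_index_enum => /(_ isT) /=.
rewrite psumr_eq0 => [/allP /(_ j)|k _]; last exact: t0.
rewrite mem_index_enum => /(_ isT) /=; rewrite [map_mx _ _ _ _]mxE qj eqxx mulr1 mulf_eq0.
by rewrite (negbTE pi) orbF => /eqP.
Qed.

Lemma relentE n (A B : 'M[C]_n) : supp_le A B -> relent A B = (trent A B)%:E.
Proof. by move=> h; rewrite /relent; case: asboolP. Qed.

Lemma relent_pinfty n (A B : 'M[C]_n) : ~ supp_le A B -> relent A B = +oo%E.
Proof. by move=> h; rewrite /relent; case: asboolP. Qed.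

End FunctionalCalculus.

(** * Hilbert-Schmidt orthonormal bases and densities of restrictions *)

Section OrthonormalBases.
Variable R : realType.
Local Notation C := (R[i]).
Local Notation r2c := (real_complex R).

(** The rank of [S] bounds the size of orthonormal families in [V], so one of maximal size exists. A
    vector that it does not reproduce would leave a nonzero residual orthogonal to the family, and
    the normalized residual would extend it. *)
Lemma max_orthonormal_family N D (V : set 'rV[C]_N) (S : 'M[C]_(D, N)) :
  lin_closed V -> (forall v, V v -> (v <= S)%MS) ->
  exists k (F : 'M[C]_(k, N)), [/\ (k <= D)%N, F *m adjmx F = 1%:M,
    forall i, V (row i F) & forall v, V v -> v = v *m adjmx F *m F].
Proof.
move=> hV hS; have [V0 Vlin] := hV.
pose P k := `[< exists F : 'M[C]_(k, N),
  F *m adjmx F = 1%:M /\ forall i, V (row i F) >].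
have exP : exists k, P k.
  exists 0; apply/asboolP; exists 0; split=> [|[]//].
  by apply/matrixP; case.
have bP k : P k -> (k <= D)%N.
  move=> /asboolP [F [hF hr]]; apply: leq_trans (rank_leq_row S).
  have <- : \rank F = k by apply/eqP; apply/row_freeP; exists (adjmx F).
  by apply: mxrankS; apply/row_subP => i; exact: hS.
case: (ex_maxnP exP bP) => k Pk kmax; have /asboolP [F [hF hr]] := Pk.
exists k, F; split=> //; first exact: bP.
move=> v hv; apply/eqP; rewrite -subr_eq0; apply/negP => /negP w0.
set w := v - _ in w0.
have wV : V w.
  rewrite /w addrC -scaleN1r; apply: Vlin => //.
  by rewrite mulmx_sum_row; apply: lin_closed_sum.
have wF : w *m adjmx F = 0 by rewrite mulmxBl -(mulmxA _ F) hF mulmx1 subrr.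
have [x [x0 xw]] : exists x : R, 0 < x /\ w *m adjmx w = (r2c x)%:M.
  exists (\sum_j sqn (w 0 j)); split.
    rewrite lt_def sumr_ge0 ?andbT => [|j _]; last exact: sqn_ge0.
    apply: contra w0; rewrite psumr_eq0 => [/allP h|j _]; last exact: sqn_ge0.
    apply/eqP/matrixP => i j; rewrite ord1 [RHS]mxE; apply/eqP.
    by rewrite -sqn_eq0; apply: (h j); rewrite mem_index_enum.
  apply/matrixP => i j; rewrite !ord1 [RHS]mxE eqxx mulr1n mxE r2c_sum.
  by apply: eq_bigr => l _; rewrite adjmxE mul_conjC_sqn.
pose a := r2c (Num.sqrt x)^-1.
have /kmax : P (k + 1)%N.
  apply/asboolP; exists (col_mx F (a *: w)); split; last first.
    move=> i; case: (split_ordP i) => j ->; rewrite ?rowKu ?rowKd //.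
    by rewrite row_id; exact: lin_closedZ.
  have -> : adjmx (col_mx F (a *: w)) = row_mx (adjmx F) (adjmx (a *: w)).
    by rewrite /adjmx map_col_mx tr_col_mx.
  rewrite mul_col_row hF adjmxZ -!scalemxAl -!scalemxAr wF scaler0.
  have -> : F *m adjmx w = 0 by rewrite -[LHS]adjmxK adjmxM adjmxK wF /adjmx map_mx0 trmx0.
  rewrite scaler0 xw /a conj_r2c !scale_scalar_mx -!rmorphM mulrA -invfM.
  by rewrite -expr2 sqr_sqrtr ?ltW // mulVf ?gt_eqF // -scalar_mx_block.
by rewrite addn1 ltnn.
Qed.

Lemma mxvec_dot m n (A B : 'M[C]_(m, n)) :
  (mxvec A *m adjmx (mxvec B)) 0 0 = \tr (A *m adjmx B).
Proof.
rewrite mxE (reindex _ (curry_mxvec_bij _ _)) /=.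
rewrite /mxtrace [RHS](eq_bigr (fun i => \sum_j A i j * Num.conj (B i j))).
  rewrite pair_bigA; apply: eq_bigr => -[i j] _ /=.
  by rewrite adjmxE !mxvecE.
by move=> i _; rewrite mxE; apply: eq_bigr => j _; rewrite adjmxE.
Qed.

Lemma orthonormal_basis_mx m n D (V : set 'M[C]_(m, n)) (S : 'M[C]_(D, m * n)) :
  lin_closed V -> (forall v, V v -> (mxvec v <= S)%MS) ->
  exists k (f : 'I_k -> 'M[C]_(m, n)), [/\ (k <= D)%N,
    forall i j, \tr (f i *m adjmx (f j)) = (i == j)%:R,
    forall i, V (f i) &
    forall v, V v -> v = \sum_i \tr (v *m adjmx (f i)) *: f i].
Proof.
move=> [V0 Vlin] hS.
have [||k [F [kD hF hr hv]]] := @max_orthonormal_family _ D (fun x => V (vec_mx x)) S.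
- split=> [|a x y hx hy]; first by rewrite linear0.
  by rewrite linearP; exact: Vlin.
- by move=> v /hS; rewrite vec_mxK.
exists k, (fun i => vec_mx (row i F)); split=> //.
  move=> i j; rewrite -mxvec_dot !vec_mxK.
  move/matrixP: hF => /(_ i j); rewrite !mxE => <-.
  by apply: eq_bigr => l _; rewrite !mxE.
move=> v Vv; have := hv (mxvec v); rewrite mxvecK => /(_ Vv) e.
rewrite -[LHS]mxvecK e mulmx_sum_row linear_sum; apply: eq_bigr => i _.
rewrite linearZ /= -mxvec_dot vec_mxK; congr (_ *: _).
by rewrite !mxE; apply: eq_bigr => l _; rewrite !mxE.
Qed.

Section Restriction.
Variables (n : nat) (B : set 'M[C]_n).
Hypothesis hB : star_subalg B.

Let hL : lin_closed B. Proof. exact/mxalg_lin/star_subalg_mxalg. Qed.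

(** The density is the orthogonal projection of [A] onto [B] for the Hilbert-Schmidt product;
    closure of [B] under adjoints turns the inner products into traces against elements of [B]. *)
Lemma restr_density_exists (A : 'M[C]_n) :
  exists D, B D /\ forall b, B b -> \tr (D *m b) = \tr (A *m b).
Proof.
have [||k [f [_ _ fB hf]]] := @orthonormal_basis_mx n n (n * n) B 1%:M => //.
  by move=> v _; exact: submx1.
exists (\sum_i \tr (A *m adjmx (f i)) *: f i); split.
  exact: lin_closed_sum.
move=> b Bb; have [_ _ _ /(_ b Bb)/hf e] := hB.
have eb : b = \sum_i \tr (f i *m b) *: adjmx (f i).
  rewrite -{1}[b]adjmxK {1}e adjmx_sum; apply: eq_bigr => i _.
  by rewrite adjmxZ -adjmxM tr_adjmx conjCK.
rewrite {2}eb mulmx_suml mulmx_sumr !linear_sum /=; apply: eq_bigr => i _.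
by rewrite -scalemxAl -scalemxAr !linearZ /= mulrC.
Qed.

Lemma restr_densityP (A : 'M[C]_n) : B (restr_density B A) /\
  forall b, B b -> \tr (restr_density B A *m b) = \tr (A *m b).
Proof.
rewrite /restr_density; case: xgetP => [D _ //|h].
by have [D hD] := restr_density_exists A; case: (h D).
Qed.

(** The difference [Z] of two candidates lies in [B] together with its adjoint; testing against
    [adjmx Z] shows that its Hilbert-Schmidt norm is 0. *)
Lemma restr_density_unique (A D : 'M[C]_n) : B D ->
  (forall b, B b -> \tr (D *m b) = \tr (A *m b)) -> D = restr_density B A.
Proof.
move=> BD hD; have [BE hE] := restr_densityP A.
apply/eqP; rewrite -subr_eq0; apply/eqP/tr_mul_adjmx_eq0.
set Z := D - _; have BZ : B Z.
  by rewrite /Z addrC -scaleN1r; apply: hL.2.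
have BZ' : B (adjmx Z) by case: hB => _ _ _; apply.
by rewrite mulmxBl linearB /= hD // hE // subrr.
Qed.

Lemma restr_density_id (A : 'M[C]_n) : B A -> restr_density B A = A.
Proof. by move=> BA; rewrite -(restr_density_unique BA). Qed.

Lemma restr_density_eq (A D : 'M[C]_n) :
  (forall b, B b -> \tr (D *m b) = \tr (A *m b)) ->
  restr_density B D = restr_density B A.
Proof.
move=> h; have [BE hE] := restr_densityP D.
by apply: restr_density_unique => // b Bb; rewrite hE // h.
Qed.

Lemma tr_restr_density (A : 'M[C]_n) : \tr (restr_density B A) = \tr A.
Proof.
have [_ /(_ 1%:M)] := restr_densityP A; rewrite !mulmx1; apply.
by case: hB.
Qed.

Lemma restr_density_adj (A : 'M[C]_n) : adjmx A = A ->
  adjmx (restr_density B A) = restr_density B A.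
Proof.
move=> hA; have [BE hE] := restr_densityP A; have [_ _ _ Badj] := hB.
apply: restr_density_unique; first exact: Badj.
move=> b Bb; rewrite -[in LHS](adjmxK b) -adjmxM tr_adjmx mxtrace_mulC hE; last exact: Badj.
by rewrite -tr_adjmx adjmxM adjmxK hA mxtrace_mulC.
Qed.

(** The spectral projection of the restricted density at an eigenvalue lies in [B]. Its trace
    against that density is the eigenvalue times a positive multiplicity, and equals its trace
    against [A], which is nonnegative. *)
Lemma restr_density_psd (A : 'M[C]_n) : psd A -> psd (restr_density B A).
Proof.
move=> hA; have [BE hE] := restr_densityP A.
have [U [p [hU e]]] := hermitian_spec (restr_density_adj hA.1).
rewrite e in BE hE *; apply: spec_psd => i.
have [V [q [hV eA hq]]] := psd_spec hA.
have /hE := mxalg_delta (p 0 i) (star_subalg_mxalg hB) hU BE.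
rewrite eA specM // tr_spec // tr_specM => /complexI.
set m := map_mx _ p => h.
have : 0 <= \sum_k p 0 i * m 0 k.
  rewrite (eq_bigr (fun k => (\row_l (p 0 l * m 0 l)) 0 k)) => [|k _].
    rewrite h; apply: sumr_ge0 => k _; apply: sumr_ge0 => l _.
    by rewrite !mulr_ge0 ?sqn_ge0 // mxE ler0n.
  by rewrite !mxE; case: eqP => [->|]; rewrite ?mulr0.
rewrite -mulr_sumr pmulr_lge0 // (bigD1 i) //= mxE eqxx ltr_pwDl ?ltr01 //.
by apply: sumr_ge0 => k _; rewrite mxE ler0n.
Qed.

End Restriction.
End OrthonormalBases.

(** * Monotonicity of relative entropy under restriction to a subalgebra *)

Section Monotonicity.
Variable R : realType.
Local Notation C := (R[i]).
Local Notation r2c := (real_complex R).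

Lemma is_derive_sum_ln n (c x : 'I_n -> R) (t : R) : (forall i, 0 < x i + t) ->
  is_derive t 1 (fun t => \sum_i c i * ln (x i + t)) (\sum_i c i / (x i + t)).
Proof.
move=> h; rewrite (_ : (fun _ => _) = \sum_i (fun t => c i * ln (x i + t))); last first.
  by apply/funext => s; rewrite fct_sumE.
apply: is_derive_sum => i.
have d1 : is_derive t 1 (fun t => x i + t) 1.
  rewrite -[X in is_derive _ _ _ X]add0r.
  exact: (is_deriveD (is_derive_cst (x i) t 1) (is_derive_id t 1)).
have d2 : is_derive (x i + t) 1 (@ln R) (x i + t)^-1 by exact: is_derive1_ln.
have := @is_derive1_comp _ (@ln R) (fun t => x i + t) t _ _ d2 d1.
rewrite mulr1 => d3; exact: is_deriveZ.
Qed.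

(* Integrating the hypothesis over t > 0, where both sides are derivatives in t. *)
Lemma sum_ln_le m n (c x : 'I_m -> R) (a y : 'I_n -> R) :
  (forall i, 0 <= c i) -> (forall i, 0 < x i) ->
  (forall j, 0 <= a j) -> (forall j, 0 < y j) ->
  \sum_i c i = \sum_j a j ->
  (forall t : R, 0 < t -> \sum_j a j / (y j + t) <= \sum_i c i / (x i + t)) ->
  \sum_i c i * ln (x i) <= \sum_j a j * ln (y j).
Proof.
move=> c0 x0 a0 y0 eca h.
pose f t := \sum_i c i * ln (x i + t) - \sum_j a j * ln (y j + t).
pose df t := \sum_i c i / (x i + t) - \sum_j a j / (y j + t).
have dfE (t : R) : 0 <= t -> is_derive t 1 f (df t).
  move=> t0; apply: is_deriveB; apply: is_derive_sum_ln => i; exact: ltr_wpDr.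
have f0t (t : R) : 0 < t -> f 0 <= f t.
  move=> t0; have [||u /andP[u0 _] e] := @MVT _ f df 0 t t0.
  - by move=> u; rewrite in_itv /= => /andP[/ltW u0 _]; exact: dfE.
  - apply: derivable_within_continuous => u; rewrite in_itv /= => /andP[u0 _].
    by case: (dfE u u0).
  rewrite -subr_ge0 e subr0 mulr_ge0 ?(ltW t0) // subr_ge0; apply: h.
  by move: u0; rewrite bnd_simp.
pose K := \sum_i c i * x i.
have K0 : 0 <= K by apply: sumr_ge0 => i _; rewrite mulr_ge0 // ltW.
(* Here [ln (x + t)] is at most [ln t + x / t] and [ln (y + t)] is at least [ln t]; the [ln t] terms
   cancel because the total masses agree. *)
have fK (t : R) : 0 < t -> f t <= K / t.
  move=> t0; rewrite /f lerBlDr.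
  apply: (@le_trans _ _ (\sum_i (c i * x i / t + c i * ln t))).
    apply: ler_sum => i _; rewrite -mulrA -mulrDr ler_wpM2l //.
    have -> : x i + t = (1 + x i / t) * t by field; rewrite gt_eqF.
    have p1 : 0 < 1 + x i / t by rewrite addr_gt0 // divr_gt0.
    rewrite lnM ?posrE // lerD2r le_ln1Dx //.
    by rewrite (lt_trans _ (divr_gt0 (x0 i) t0)) // ltrN10.
  rewrite big_split /= -!mulr_suml lerD2l eca mulr_suml; apply: ler_sum => j _.
  rewrite ler_wpM2l // ler_ln ?posrE ?addr_gt0 //.
  by rewrite lerDr ltW.
have : f 0 <= 0.
  rewrite leNgt; apply/negP => f0.
  have K1 : 0 < K + 1 by rewrite ltr_wpDl.
  (* At this [t] the bound [K / t] falls below [f 0]; the summand 1 keeps [t] positive even if [K]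
     is 0. *)
  have t0 : 0 < (K + 1) / f 0 by rewrite divr_gt0.
  have := le_trans (f0t _ t0) (fK _ t0); rewrite leNgt => /negP; apply.
  rewrite invf_div mulrCA -[X in _ < X]mulr1 ltr_pM2l //.
  by rewrite ltr_pdivrMr // mul1r ltrDl ltr01.
rewrite /f subr_le0; under eq_bigr do rewrite addr0.
by under [X in _ <= X]eq_bigr do rewrite addr0.
Qed.

(** With [c = w p] and [x = q / p] this is the sum of [c / (x + t)], the derivative in [t] of the
    sum of [c ln (x + t)]. Under the support condition the latter sum is minus the relative entropy
    at [t = 0]. *)
Definition entF n (U V : 'M[C]_n) (p q : 'rV[R]_n) (t : R) : R :=
  \sum_i \sum_j weight U V i j * (p 0 i ^+ 2 / (q 0 j + t * p 0 i)).

Definition qform n (r s X : 'M[C]_n) (t : R) : R :=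
  2 * complex.Re (\tr (r *m X)) - complex.Re (\tr (s *m (X *m adjmx X)))
  - t * complex.Re (\tr (r *m (adjmx X *m X))).

(** In the eigenbases the form decouples into one scalar quadratic polynomial for each entry of [Y],
    so it can be maximized entry by entry. *)
Lemma qformE n (U V Y : 'M[C]_n) (p q : 'rV[R]_n) (t : R) :
  unitarymx' U -> unitarymx' V ->
  qform (spec U p) (spec V q) (V *m Y *m adjmx U) t =
  \sum_i \sum_j (2 * (p 0 i * complex.Re ((adjmx U *m V) i j * Y j i))
     - (q 0 j + t * p 0 i) * sqn (Y j i)).
Proof.
move=> hU hV; rewrite /qform.
have e1 : \tr (spec U p *m (V *m Y *m adjmx U)) =
    \tr (cdiag p *m (adjmx U *m V *m Y)).
  rewrite /spec -!mulmxA mxtrace_mulC -!mulmxA.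
  by rewrite (unitarymx_adj hU) mulmx1.
have KU k (Z : 'M[C]_(n, k)) : adjmx U *m (U *m Z) = Z.
  by rewrite mulmxA unitarymx_adj // mul1mx.
have KV k (Z : 'M[C]_(n, k)) : adjmx V *m (V *m Z) = Z.
  by rewrite mulmxA unitarymx_adj // mul1mx.
have e2 : \tr (spec V q *m (V *m Y *m adjmx U *m adjmx (V *m Y *m adjmx U))) =
    \tr (cdiag q *m (Y *m adjmx Y)).
  rewrite /spec !adjmxM adjmxK -!mulmxA mxtrace_mulC -!mulmxA KV KU.
  by rewrite (unitarymx_adj hV) mulmx1.
have e3 : \tr (spec U p *m (adjmx (V *m Y *m adjmx U) *m (V *m Y *m adjmx U))) =
    \tr (cdiag p *m (adjmx Y *m Y)).
  rewrite /spec !adjmxM adjmxK -!mulmxA mxtrace_mulC -!mulmxA KU KV.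
  by rewrite (unitarymx_adj hU) mulmx1.
rewrite e1 e2 e3; move=> {e1 e2 e3}; rewrite /mxtrace !ReC_sum.
rewrite [X in _ - X - _](_ : _ = \sum_i \sum_j q 0 j * sqn (Y j i)); last first.
  rewrite exchange_big /=; apply: eq_bigr => j _; rewrite mul_cdiag ReC_mul_r2c.
  rewrite mxE ReC_sum mulr_sumr; apply: eq_bigr => i _.
  by rewrite adjmxE mul_conjC_sqn.
rewrite !mulr_sumr -!sumrB; apply: eq_bigr => i _.
rewrite !mul_cdiag !ReC_mul_r2c [X in complex.Re X]mxE.
rewrite [X in t * (_ * complex.Re X)]mxE !ReC_sum !mulr_sumr -!sumrB.
apply: eq_bigr => j _; rewrite adjmxE [Num.conj _ * _]mulrC mul_conjC_sqn ReC_r2c.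
by ring.
Qed.

Lemma qform_le n (U V X : 'M[C]_n) (p q : 'rV[R]_n) (t : R) :
  unitarymx' U -> unitarymx' V -> (forall i, 0 <= p 0 i) -> (forall i, 0 <= q 0 i) ->
  0 < t -> qform (spec U p) (spec V q) X t <= entF U V p q t.
Proof.
move=> hU hV hp hq t0.
have -> : X = V *m (adjmx V *m X *m U) *m adjmx U.
  rewrite !mulmxA (hV : V *m _ = _) mul1mx -mulmxA (hU : U *m _ = _) mulmx1 //.
rewrite qformE //; apply: ler_sum => i _; apply: ler_sum => j _.
rewrite /weight; set w := (adjmx U *m V) i j; set y := (adjmx V *m X *m U) j i.
have := hp i; rewrite le_eqVlt => /predU1P[<-|pi].
  rewrite mul0r mulr0 mulr0 addr0 sub0r expr2 mul0r mul0r mulr0 oppr_le0.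
  by rewrite mulr_ge0 ?sqn_ge0.
have D0 : 0 < q 0 j + t * p 0 i by rewrite ltr_wpDl // mulr_gt0.
set D := q 0 j + _ in D0 *; rewrite [X in _ <= X]mulrA ler_pdivlMr //.
rewrite -subr_ge0 {D0}; move: (p 0 i) D w y => x D [a b] [c d]; rewrite /sqn /=.
have -> : (a ^+ 2 + b ^+ 2) * x ^+ 2 -
   (2 * (x * (a * c - b * d)) - D * (c ^+ 2 + d ^+ 2)) * D =
   (x * a - D * c) ^+ 2 + (x * b + D * d) ^+ 2 by ring.
by rewrite addr_ge0 ?sqr_ge0.
Qed.

(** The square left over in [qform_le] vanishes when the entry is [p / (q + t p)] times the
    conjugate overlap. *)
Lemma qform_max n (U V : 'M[C]_n) (p q : 'rV[R]_n) (t : R) :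
  unitarymx' U -> unitarymx' V -> (forall i, 0 <= p 0 i) -> (forall i, 0 <= q 0 i) ->
  0 < t ->
  qform (spec U p) (spec V q)
    (V *m (\matrix_(j, i) (r2c (p 0 i / (q 0 j + t * p 0 i)) * (adjmx V *m U) j i))
       *m adjmx U) t = entF U V p q t.
Proof.
move=> hU hV hp hq t0; rewrite qformE //.
apply: eq_bigr => i _; apply: eq_bigr => j _; rewrite /weight.
have -> : (adjmx V *m U) = adjmx (adjmx U *m V) by rewrite adjmxM adjmxK.
rewrite [(\matrix_(_, _) _) _ _]mxE adjmxE; set w := (adjmx U *m V) i j.
(* If [p 0 i] is 0, the denominator may be 0 as well; the numerator makes the entry 0 in any
   case. *)
have := hp i; rewrite le_eqVlt => /predU1P[<-|pi].
  have s0 : sqn (0 : C) = 0 by apply/eqP; rewrite sqn_eq0.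
  by rewrite expr0n /= !(mul0r, mulr0) s0 mulr0 subr0.
have D0 : 0 < q 0 j + t * p 0 i by rewrite ltr_wpDl // mulr_gt0.
set D := q 0 j + _ in D0 *.
rewrite [w * _]mulrCA mul_conjC_sqn ReC_mul_r2c sqnM sqn_conj.
rewrite [sqn (r2c _)]/sqn /= expr0n addr0.
by field; rewrite gt_eqF.
Qed.

Definition entc n (U V : 'M[C]_n) (p : 'rV[R]_n) (k : 'I_n * 'I_n) : R :=
  weight U V k.1 k.2 * p 0 k.1.

(** The likelihood ratio of a classical pair of distributions on pairs of indices. The value 1 at
    pairs of mass 0 does not affect the entropy and keeps the ratio positive, as [sum_ln_le]
    requires. *)
Definition entx n (U V : 'M[C]_n) (p q : 'rV[R]_n) (k : 'I_n * 'I_n) : R :=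
  if entc U V p k == 0 then 1 else q 0 k.2 / p 0 k.1.

Lemma entx_gt0 n (U V : 'M[C]_n) (p q : 'rV[R]_n) k :
  unitarymx' U -> unitarymx' V -> (forall i, 0 <= p 0 i) -> (forall i, 0 <= q 0 i) ->
  supp_le (spec U p) (spec V q) -> 0 < entx U V p q k.
Proof.
move=> hU hV hp hq; rewrite supp_le_spec // /entx /entc => h.
have [|neq] := ifPn; first by rewrite ltr01.
move: neq; rewrite mulf_eq0 negb_or => /andP[w0 p0].
rewrite divr_gt0 // lt_def ?p0 ?hp ?hq ?andbT //.
by apply: contra w0 => /eqP q0; rewrite h.
Qed.

Lemma trent_entx n (U V : 'M[C]_n) (p q : 'rV[R]_n) :
  unitarymx' U -> unitarymx' V -> (forall i, 0 <= p 0 i) -> (forall i, 0 <= q 0 i) ->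
  supp_le (spec U p) (spec V q) ->
  trent (spec U p) (spec V q) = - \sum_k entc U V p k * ln (entx U V p q k).
Proof.
move=> hU hV hp hq hs; rewrite trentE // pair_bigA -sumrN.
apply: eq_bigr => -[i j] _ /=; have := entx_gt0 (i, j) hU hV hp hq hs.
rewrite /entx /entc /=.
have [/eqP e _|neq] := ifPn; first by rewrite ln1 mulr0 oppr0 mulrA e mul0r.
move=> x0; have p0 : 0 < p 0 i.
  by rewrite lt_def hp andbT; apply: contra neq => /eqP ->; rewrite mulr0.
have q0 : 0 < q 0 j by move: x0; rewrite pmulr_lgt0 // invr_gt0.
rewrite /lnp p0 q0 ln_div ?posrE //; ring.
Qed.

Lemma entF_entx n (U V : 'M[C]_n) (p q : 'rV[R]_n) t :
  (forall i, 0 <= p 0 i) ->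
  entF U V p q t = \sum_k entc U V p k / (entx U V p q k + t).
Proof.
move=> hp; rewrite /entF pair_bigA; apply: eq_bigr => -[i j] _ /=.
rewrite /entx /entc /=.
have [/eqP e|neq] := ifPn; first by rewrite e mul0r expr2 -mulrA mulrA e mul0r.
have p0 : p 0 i != 0 by apply: contra neq => /eqP ->; rewrite mulr0.
rewrite -mulrA; congr (_ * _).
have -> : q 0 j / p 0 i + t = (q 0 j + t * p 0 i) / p 0 i by field.
by rewrite invf_div expr2 -mulrA; congr (_ * _); rewrite mulrC.
Qed.

Lemma sum_entc n (U V : 'M[C]_n) (p : 'rV[R]_n) : unitarymx' U -> unitarymx' V ->
  \tr (spec U p) = r2c (\sum_k entc U V p k).
Proof.
move=> hU hV; rewrite tr_spec //; congr (r2c _).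
rewrite -(pair_bigA _ (fun i j => entc U V p (i, j))) /=; apply: eq_bigr => i _.
by rewrite /entc /= -mulr_suml weight_row // mul1r.
Qed.

Section DataProcessing.
Variables (n : nat) (B : set 'M[C]_n) (r s : 'M[C]_n).
Hypotheses (hB : star_subalg B) (hr : psd r) (hs : psd s).

Lemma qform_restr X t : B X ->
  qform (restr_density B r) (restr_density B s) X t = qform r s X t.
Proof.
move=> BX; have [_ _ BM /(_ X BX) BX'] := hB.
have [_ er] := restr_densityP hB r; have [_ es] := restr_densityP hB s.
by rewrite /qform !er ?es //; exact: BM.
Qed.

(** The kernel projection [P] of the restricted [s] lies in [B], so [s] also has trace 0 against it.
    Hence the kernel of the restricted [s] lies in that of [s], thus in that of [r], and the trace
    of [r] against [P] is 0 too. *)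
Lemma supp_le_restr : supp_le r s ->
  supp_le (restr_density B r) (restr_density B s).
Proof.
have hr' := restr_density_psd hB hr; have hs' := restr_density_psd hB hs.
have [_ er] := restr_densityP hB r; have [Bs es] := restr_densityP hB s.
move=> h; set P := kerproj (restr_density B s).
have BP : B P by apply: mxalg_mxfun => //; [exact: star_subalg_mxalg|exact: hs'.1].
apply/(supp_le_kerproj hr' hs'.1); rewrite -/P er //.
have sP : supp_le s (restr_density B s).
  apply/(supp_le_kerproj hs hs'.1); rewrite -/P -es //.
  by apply/(supp_le_kerproj hs' hs'.1) => v.
by apply/(supp_le_kerproj hr hs'.1) => v /sP /h.
Qed.

Lemma trent_restr_le : supp_le r s ->
  trent (restr_density B r) (restr_density B s) <= trent r s.
Proof.
move=> hsupp; have := supp_le_restr hsupp.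
have [Br _] := restr_densityP hB r; have [Bs _] := restr_densityP hB s.
have hq := fun X t (BX : B X) => qform_restr t BX.
have := tr_restr_density hB r.
have [U' [p' [hU' er' hp']]] := psd_spec (restr_density_psd hB hr).
have [V' [q' [hV' es' hq']]] := psd_spec (restr_density_psd hB hs).
have [U [p [hU er hp]]] := psd_spec hr; have [V [q [hV es hqq]]] := psd_spec hs.
rewrite er' es' in Br Bs hq *; rewrite er es in hq hsupp * => htr hsupp'.
rewrite !trent_entx // lerN2.
rewrite (reindex _ (onW_bij _ (@enum_val_bij ('I_n * 'I_n)%type))) /=.
rewrite [X in _ <= X](reindex _ (onW_bij _ (@enum_val_bij ('I_n * 'I_n)%type))) /=.
have red (F : 'I_n * 'I_n -> R) :
    \sum_k F k = \sum_(k < #|{: 'I_n * 'I_n}|) F (enum_val k).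
  by rewrite (reindex _ (onW_bij _ (@enum_val_bij ('I_n * 'I_n)%type))).
apply: sum_ln_le => [k|k|k|k||t t0].
- by rewrite mulr_ge0 ?weight_ge0.
- exact: entx_gt0.
- by rewrite mulr_ge0 ?weight_ge0.
- exact: entx_gt0.
- by move: htr; rewrite !(sum_entc _ hU hV) (sum_entc _ hU' hV') => /complexI; rewrite !red.
rewrite -(red (fun k => entc U' V' p' k / (entx U' V' p' q' k + t))).
rewrite -(red (fun k => entc U V p k / (entx U V p q k + t))).
(* The maximizer for the restricted densities lies in [B], where the two forms agree, and the form
   of [r] and [s] never exceeds its own maximum. *)
rewrite -!entF_entx // -qform_max // hq; first exact: qform_le.
exact: (mxalg_fun2 (fun y x => x / (y + t * x)) (star_subalg_mxalg hB)).
Qed.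

End DataProcessing.
End Monotonicity.

(** * Entropy bounds from a dominating state, and the square sum of an orthonormal basis *)

Section UniversalBounds.
Variable R : realType.
Local Notation C := (R[i]).
Local Notation r2c := (real_complex R).

Definition quad n (A : 'M[C]_n) (v : 'cV[C]_n) : R :=
  complex.Re ((adjmx v *m A *m v) 0 0).

Lemma quadE n (U : 'M[C]_n) (p : 'rV[R]_n) v :
  quad (spec U p) v = \sum_i p 0 i * sqn ((adjmx U *m v) i 0).
Proof. by rewrite /quad quad_spec. Qed.

Lemma ln_le_sub1 (x : R) : 0 < x -> ln x <= x - 1.
Proof.
move=> x0; have := @le_ln1Dx R (x - 1); rewrite [1 + _]addrC subrK; apply.
by rewrite ltrBrDl subrr.
Qed.

(** Klein's inequality: each [p (ln p - ln q)] is at least [p - q], and the weighted sum of these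
    differences is 0 because the weights are doubly stochastic and the traces agree. *)
Lemma trent_ge0 n (U V : 'M[C]_n) (p q : 'rV[R]_n) :
  unitarymx' U -> unitarymx' V -> (forall i, 0 <= p 0 i) -> (forall i, 0 < q 0 i) ->
  \tr (spec U p) = \tr (spec V q) -> 0 <= trent (spec U p) (spec V q).
Proof.
move=> hU hV hp hq; rewrite !tr_spec // => /complexI e.
have -> : 0 = \sum_i \sum_j weight U V i j * (p 0 i - q 0 j) :> R.
  under eq_bigr => i _ do
    under eq_bigr => j _ do rewrite mulrBr.
  under eq_bigr => i _ do rewrite sumrB -mulr_suml weight_row // mul1r.
  rewrite sumrB exchange_big /=.
  under [X in _ - X]eq_bigr => j _ do rewrite -mulr_suml weight_col // mul1r.
  by rewrite e subrr.
rewrite trentE //; apply: ler_sum => i _; apply: ler_sum => j _.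
rewrite ler_wpM2l ?weight_ge0 // /lnp hq.
have := hp i; rewrite le_eqVlt => /predU1P[<-|pi].
  by rewrite mul0r sub0r oppr_le0 ltW.
rewrite pi -lerN2 -mulrN !opprB.
have := ln_le_sub1 (divr_gt0 (hq j) pi); rewrite ln_div ?posrE // => h.
apply: le_trans (ler_wpM2l (ltW pi) h) _.
by rewrite mulrBr mulr1 mulrCA divff ?gt_eqF // mulr1.
Qed.

(** Instead of operator monotonicity of the logarithm, [ln z <= z - 1] is used at [z = p / (q K)]
    and averaged over [j]; the linear term is controlled by the bound [p 0 i * S <= K]. *)
Lemma trent_le_ln n (U V : 'M[C]_n) (p q : 'rV[R]_n) (K : R) :
  unitarymx' U -> unitarymx' V -> (forall i, 0 <= p 0 i) -> (forall i, 0 < q 0 i) ->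
  0 < K -> \tr (spec U p) = 1 ->
  (forall v, quad (spec U p) v <= K * quad (spec V q) v) ->
  trent (spec U p) (spec V q) <= ln K.
Proof.
move=> hU hV hp hq K0; rewrite tr_spec // => /(@complexI R _ 1) tr1 h.
rewrite trentE // -[X in _ <= X]mul1r -tr1 mulr_suml; apply: ler_sum => i _.
have := hp i; rewrite le_eqVlt => /predU1P[<-|pi].
  by rewrite mul0r big1 // => j _; rewrite mul0r mulr0.
pose S := \sum_j weight U V i j / q 0 j.
have Sle : p 0 i * S <= K.
  (* Test the operator inequality on the image of the i-th eigenvector of
     the first matrix under the inverse of the second. *)
  pose y : 'cV[C]_n := \col_j (r2c (q 0 j)^-1 * Num.conj ((adjmx U *m V) i j)).
  have := h (V *m y); rewrite !quadE mulmxA (mulmxA (adjmx V)).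
  rewrite (unitarymx_adj hV) mul1mx.
  have -> : \sum_j q 0 j * sqn (y j 0) = S.
    apply: eq_bigr => j _; rewrite mxE sqnM sqn_conj {1}/sqn /= expr0n addr0 /weight.
    by field; rewrite gt_eqF.
  have -> : \sum_k p 0 k * sqn ((adjmx U *m V *m y) k 0) =
     p 0 i * S ^+ 2 + \sum_(k | k != i) p 0 k * sqn ((adjmx U *m V *m y) k 0).
    rewrite (bigD1 i) //=; congr (_ * _ + _).
    have -> : (adjmx U *m V *m y) i 0 = r2c S.
      rewrite mxE /S r2c_sum; apply: eq_bigr => j _.
      by rewrite [y _ _]mxE mulrCA mul_conjC_sqn -rmorphM mulrC.
    by rewrite /sqn /= expr0n addr0.
  move=> h'; have {h'} h' : p 0 i * S ^+ 2 <= K * S.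
    apply: le_trans h'; rewrite lerDl; apply: sumr_ge0 => k _.
    by rewrite mulr_ge0 ?sqn_ge0.
  have S0 : 0 <= S.
    by apply: sumr_ge0 => j _; rewrite divr_ge0 ?weight_ge0 // ltW.
  move: S0; rewrite le_eqVlt => /predU1P[<-|S0]; first by rewrite mulr0 ltW.
  by rewrite -(ler_pM2r S0) -mulrA -expr2.
apply: (@le_trans _ _ (\sum_j (weight U V i j * (p 0 i * (ln K - 1)) +
    weight U V i j / q 0 j * (p 0 i ^+ 2 / K)))).
  apply: ler_sum => j _.
  rewrite -mulrA -mulrDr ler_wpM2l ?weight_ge0 // /lnp hq pi.
  have x0 : 0 < p 0 i / (q 0 j * K) by rewrite divr_gt0 ?mulr_gt0.
  have := ln_le_sub1 x0; rewrite ln_div ?posrE ?mulr_gt0 // lnM ?posrE // => hl.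
  have -> : p 0 i * (ln K - 1) + (q 0 j)^-1 * (p 0 i ^+ 2 / K) =
     p 0 i * (ln K - 1 + p 0 i / (q 0 j * K)).
    by field; rewrite !gt_eqF.
  by rewrite ler_wpM2l //; lra.
rewrite big_split /= -!mulr_suml weight_row // mul1r -/S.
have -> : S * (p 0 i ^+ 2 / K) = p 0 i * (p 0 i * S / K) by ring.
rewrite -mulrDr ler_wpM2l // -addrA gerDl addrC subr_le0.
by rewrite ler_pdivrMr // mul1r.
Qed.

Lemma trentB n (A B : 'M[C]_n) : trent A B =
  complex.Re (\tr (A *m mxlog A)) - complex.Re (\tr (A *m mxlog B)).
Proof. by rewrite /trent mulmxBr raddfB ReCB. Qed.

Lemma trent_lower n (r s X T : 'M[C]_n) (K : R) :
  \tr (X *m mxlog T) = \tr (r *m mxlog T) ->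
  \tr (X *m mxlog s) = \tr (r *m mxlog s) ->
  0 <= trent X T -> trent r T <= ln K -> trent r s - ln K <= trent X s.
Proof.
rewrite !trentB => -> ->; move: (complex.Re _) (complex.Re _) (complex.Re _).
move: (complex.Re _) => a b c e; lra.
Qed.

Lemma adjmx_sqB m n (g y : 'M[C]_(m, n)) c :
  adjmx (g - c *: y) *m (g - c *: y) = adjmx g *m g - c *: (adjmx g *m y)
    - Num.conj c *: (adjmx y *m g) + (c * Num.conj c) *: (adjmx y *m y).
Proof.
rewrite adjmxB adjmxZ mulmxBr !mulmxBl -!scalemxAl -!scalemxAr scalerA opprB addrA.
by rewrite [LHS]addrAC [X in X + _ = _]addrAC [Num.conj _ * _]mulrC.
Qed.

(** Both cross terms equal [adjmx y *m y]. The gap in the Cauchy-Schwarz inequality is thereby an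
    explicit sum of squares. *)
Lemma sum_sq_dist m n k (c : 'I_k -> C) (g : 'I_k -> 'M[C]_(m, n)) y :
  \sum_i c i * Num.conj (c i) = 1 -> y = \sum_i Num.conj (c i) *: g i ->
  \sum_i adjmx (g i - c i *: y) *m (g i - c i *: y) =
  \sum_i adjmx (g i) *m g i - adjmx y *m y.
Proof.
move=> c1 yE; under eq_bigr => i _ do rewrite adjmx_sqB.
rewrite big_split /= -scaler_suml c1 scale1r !sumrB -addrA.
have -> : \sum_i Num.conj (c i) *: (adjmx y *m g i) = adjmx y *m y.
  rewrite [X in _ *m X]yE mulmx_sumr.
  by apply: eq_bigr => i _; rewrite scalemxAr.
have -> : \sum_i c i *: (adjmx (g i) *m y) = adjmx y *m y.
  rewrite [X in adjmx X *m _]yE adjmx_sum mulmx_suml; apply: eq_bigr => i _.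
  by rewrite adjmxZ conjCK scalemxAl.
by rewrite addNr addr0.
Qed.

(** [M] is the sum of [f i *m adjmx (f i)] over an orthonormal basis of [V], so its trace counts the
    basis. A unit vector of [V] is a combination of the basis with square-summable coefficients of
    total 1, and Cauchy-Schwarz gives the domination. *)
Lemma orthonormal_square_sum N D (V : set 'M[C]_N) (S : 'M[C]_(D, N * N)) :
  lin_closed V -> (forall v, V v -> (mxvec v <= S)%MS) ->
  exists k (M : 'M[C]_N), [/\ (k <= D)%N, \tr M = k%:R, psd M,
    forall a, (forall x, V x -> V (a *m x)) -> (forall x, V x -> V (adjmx a *m x)) ->
      a *m M = M *m a &
    forall v, V v -> \tr (v *m adjmx v) = 1 ->
      forall x, quad (v *m adjmx v) x <= quad M x].
Proof.
move=> hV hS; have [k [f [kD fo fV hf]]] := orthonormal_basis_mx hV hS.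
pose M := \sum_i f i *m adjmx (f i).
have qM x : quad M x = \sum_i quad (f i *m adjmx (f i)) x.
  rewrite /quad /M mulmx_sumr mulmx_suml summxE ReC_sum //.
have qf (v : 'M[C]_N) x : quad (v *m adjmx v) x =
    complex.Re ((adjmx (adjmx v *m x) *m (adjmx v *m x)) 0 0).
  by rewrite adjmxM adjmxK !mulmxA /quad !mulmxA.
have nn (y : 'cV[C]_N) : 0 <= (adjmx y *m y) 0 0.
  rewrite mxE sumr_ge0 // => j _; rewrite adjmxE mulrC mul_conjC_sqn ler0c.
  exact: sqn_ge0.
exists k, M; split=> //.
- by rewrite /M linear_sum /= (eq_bigr (fun=> 1)) => [|i _]; rewrite ?fo ?eqxx // sumr_const card_ord.
- split.
    by rewrite /M adjmx_sum; apply: eq_bigr => i _; rewrite adjmxM adjmxK.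
  move=> v; rewrite /M mulmx_sumr mulmx_suml summxE; apply: sumr_ge0 => i _.
  rewrite !mulmxA -mulmxA -{1}(adjmxK (f i)) -adjmxM; exact: nn.
- move=> a ha ha'.
  (* These are the matrix coefficients of left multiplication by [a] on [V]. Those of [adjmx a] form
     the conjugate transpose, so [M *m a] expands to the same sum. *)
  have ->: a *m M = \sum_i \sum_j \tr (a *m f i *m adjmx (f j)) *: (f j *m adjmx (f i)).
    rewrite /M mulmx_sumr; apply: eq_bigr => i _; rewrite mulmxA.
    by rewrite {1}(hf _ (ha _ (fV i))) mulmx_suml; apply: eq_bigr => j _; rewrite scalemxAl.
  rewrite exchange_big /= /M mulmx_suml; apply: eq_bigr => j _.
  rewrite -mulmxA -[X in _ = _ *m X]adjmxK adjmxM adjmxK.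
  rewrite [in RHS](hf _ (ha' _ (fV j))) adjmx_sum mulmx_sumr; apply: eq_bigr => i _.
  rewrite adjmxZ -scalemxAr; congr (_ *: _).
  by rewrite -tr_adjmx !adjmxM !adjmxK mulmxA [RHS]mxtrace_mulC mulmxA.
move=> v Vv v1 x; pose c i := \tr (v *m adjmx (f i)).
have ev : v = \sum_i c i *: f i by exact: hf.
have c1 : \sum_i c i * Num.conj (c i) = 1.
  rewrite -v1 [X in _ = \tr (X *m _)]ev mulmx_suml linear_sum; apply: eq_bigr => i _ /=.
  by rewrite -scalemxAl linearZ /= -tr_adjmx adjmxM adjmxK.
pose y := adjmx v *m x; pose g i := adjmx (f i) *m x.
have yE : y = \sum_i Num.conj (c i) *: g i.
  rewrite /y {1}ev adjmx_sum mulmx_suml; apply: eq_bigr => i _.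
  by rewrite adjmxZ -scalemxAl.
(* Cauchy-Schwarz, as the positivity of a sum of squared distances. *)
have : 0 <= complex.Re ((\sum_i adjmx (g i - c i *: y) *m (g i - c i *: y)) 0 0).
  rewrite summxE ReC_sum; apply: sumr_ge0 => i _.
  by have := nn (g i - c i *: y); rewrite lecE => /andP[].
rewrite (sum_sq_dist c1 yE).
rewrite mxE [X in _ + X]mxE ReCB subr_ge0 summxE ReC_sum qM qf.
by move=> h; apply: le_trans h _; under [X in _ <= X]eq_bigr do rewrite qf.
Qed.

End UniversalBounds.

(** * Tensor products and tensor powers: spectra, supports and additivity of entropy *)

Section TensorPowers.
Variable R : realType.
Local Notation C := (R[i]).
Local Notation r2c := (real_complex R).

Lemma castmx_mulmx m k (e : m = k) (A B : 'M[C]_m) :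
  castmx (e, e) A *m castmx (e, e) B = castmx (e, e) (A *m B).
Proof. by case: k / e. Qed.

Lemma castmx_adj m k (e : m = k) (A : 'M[C]_m) :
  adjmx (castmx (e, e) A) = castmx (e, e) (adjmx A).
Proof. by case: k / e. Qed.

Lemma castmx_one m k (e : m = k) : castmx (e, e) (1%:M : 'M[C]_m) = 1%:M.
Proof. by case: k / e. Qed.

Lemma castmx_tr m k (e : m = k) (A : 'M[C]_m) : \tr (castmx (e, e) A) = \tr A.
Proof. by case: k / e. Qed.

Lemma castmx_psd m k (e : m = k) (A : 'M[C]_m) : psd A -> psd (castmx (e, e) A).
Proof. by case: k / e. Qed.

Lemma castmx_supp_le m k (e : m = k) (A B : 'M[C]_m) :
  supp_le (castmx (e, e) A) (castmx (e, e) B) <-> supp_le A B.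
Proof. by case: k / e. Qed.

Lemma castmx_trent m k (e : m = k) (A B : 'M[C]_m) :
  trent (castmx (e, e) A) (castmx (e, e) B) = trent A B.
Proof. by case: k / e. Qed.

Lemma mxtens_sum (M : nmodType) m n (F : 'I_(m * n) -> M) :
  \sum_k F k = \sum_i \sum_j F (mxtens_index (i, j)).
Proof.
rewrite pair_bigA (reindex (@mxtens_index m n)) /=; last first.
  exists (@mxtens_unindex m n) => k _; first exact: mxtens_indexK.
  exact: mxtens_unindexK.
by apply: eq_bigr => -[].
Qed.

Lemma tens_adj m n p q (A : 'M[C]_(m, n)) (B : 'M[C]_(p, q)) :
  adjmx (A *t B) = adjmx A *t adjmx B.
Proof. by rewrite /adjmx map_mxT trmx_tens. Qed.

Lemma tens_tr m n (A : 'M[C]_m) (B : 'M[C]_n) : \tr (A *t B) = \tr A * \tr B.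
Proof.
rewrite /mxtrace mxtens_sum mulr_suml; apply: eq_bigr => i _.
by rewrite mulr_sumr; apply: eq_bigr => j _; rewrite tensmxE.
Qed.

Lemma tens_one m n : (1%:M : 'M[C]_m) *t (1%:M : 'M[C]_n) = 1%:M.
Proof.
apply/matrixP => i j; case: (mxtens_indexP i) => i0 i1; case: (mxtens_indexP j) => j0 j1.
rewrite tensmxE !mxE (can_eq (@mxtens_indexK m n)) xpair_eqE.
by rewrite -natrM mulnb.
Qed.

Definition tens_row m n (p : 'rV[R]_m) (q : 'rV[R]_n) : 'rV[R]_(m * n) :=
  \row_k (p 0 (mxtens_unindex k).1 * q 0 (mxtens_unindex k).2).

Lemma tens_rowE m n (p : 'rV[R]_m) (q : 'rV[R]_n) i j :
  tens_row p q 0 (mxtens_index (i, j)) = p 0 i * q 0 j.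
Proof. by rewrite mxE mxtens_indexK. Qed.

Lemma tens_unitary m n (U : 'M[C]_m) (V : 'M[C]_n) :
  unitarymx' U -> unitarymx' V -> unitarymx' (U *t V).
Proof.
move=> hU hV; rewrite /unitarymx' tens_adj tensmx_mul.
by rewrite (hU : U *m _ = _) (hV : V *m _ = _) tens_one.
Qed.

Lemma tens_spec m n (U : 'M[C]_m) (V : 'M[C]_n) (p : 'rV[R]_m) (q : 'rV[R]_n) :
  spec U p *t spec V q = spec (U *t V) (tens_row p q).
Proof.
rewrite /spec tens_adj -!tensmx_mul; congr (_ *m _ *m _).
apply/matrixP => i j; case: (mxtens_indexP i) => i0 i1; case: (mxtens_indexP j) => j0 j1.
rewrite tensmxE !cdiagE tens_rowE (can_eq (@mxtens_indexK m n)) xpair_eqE rmorphM /=.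
by do 2![case: eqP => _]; rewrite ?mulr0n ?mulr1n ?mulr0 ?mul0r.
Qed.

Lemma tens_row_ge0 m n (p : 'rV[R]_m) (q : 'rV[R]_n) :
  (forall i, 0 <= p 0 i) -> (forall i, 0 <= q 0 i) -> forall k, 0 <= tens_row p q 0 k.
Proof. by move=> hp hq k; rewrite mxE mulr_ge0. Qed.

Lemma tens_psd m n (A : 'M[C]_m) (B : 'M[C]_n) : psd A -> psd B -> psd (A *t B).
Proof.
move=> /psd_spec [U [p [hU -> hp]]] /psd_spec [V [q [hV -> hq]]].
by rewrite tens_spec; apply: spec_psd; exact: tens_row_ge0.
Qed.

Lemma tens_weight m n (U V : 'M[C]_m) (U' V' : 'M[C]_n) i i' j j' :
  weight (U *t U') (V *t V') (mxtens_index (i, i')) (mxtens_index (j, j')) =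
  weight U V i j * weight U' V' i' j'.
Proof. by rewrite /weight tens_adj tensmx_mul tensmxE sqnM. Qed.

Section TensorEntropy.
Variables (m n : nat) (A B : 'M[C]_m) (A' B' : 'M[C]_n).
Hypotheses (hA : psd A) (hB : psd B) (hA' : psd A') (hB' : psd B').

Lemma tens_supp_le : supp_le A B -> supp_le A' B' -> supp_le (A *t A') (B *t B').
Proof.
have [U [p [hU -> hp]]] := psd_spec hA; have [V [q [hV -> hq]]] := psd_spec hB.
have [U' [p' [hU' -> hp']]] := psd_spec hA'; have [V' [q' [hV' -> hq']]] := psd_spec hB'.
rewrite !tens_spec !supp_le_spec //; try exact: tens_unitary.
move=> h h' i j; case: (mxtens_indexP i) => i0 i1; case: (mxtens_indexP j) => j0 j1.
rewrite !tens_rowE tens_weight => /eqP; rewrite !mulf_eq0 negb_or => + /andP[pi pi'].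
by case/orP => /eqP e; [rewrite h // mul0r|rewrite h' // mulr0].
Qed.

Lemma tens_supp_leI : \tr A' = 1 -> supp_le (A *t A') (B *t B') -> supp_le A B.
Proof.
have [U [p [hU -> hp]]] := psd_spec hA; have [V [q [hV -> hq]]] := psd_spec hB.
have [U' [p' [hU' -> hp']]] := psd_spec hA'; have [V' [q' [hV' -> hq']]] := psd_spec hB'.
rewrite tr_spec // => /(@complexI R _ 1) tr1.
rewrite !tens_spec !supp_le_spec //; try exact: tens_unitary.
move=> h i j qj pi; have [i' pi'] : exists i', p' 0 i' != 0.
  apply/existsP; apply: contraPT tr1 => /existsPn /= h0.
  rewrite big1 => [/esym/eqP|k _]; first by rewrite oner_eq0.
  by apply/eqP; have := h0 k; rewrite negbK.
(* The weight is spread over the row [i'] of the second factor, whose sum is 1; each product is a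
   weight of the tensor product at a zero eigenvalue of its second matrix. *)
rewrite -[LHS]mulr1 -(weight_row i' hU' hV') mulr_sumr big1 // => j' _.
by rewrite -tens_weight h ?tens_rowE ?qj ?mul0r // mulf_neq0.
Qed.

Lemma tens_trent : supp_le A B -> supp_le A' B' ->
  trent (A *t A') (B *t B') =
  trent A B * complex.Re (\tr A') + complex.Re (\tr A) * trent A' B'.
Proof.
have [U [p [hU -> hp]]] := psd_spec hA; have [V [q [hV -> hq]]] := psd_spec hB.
have [U' [p' [hU' -> hp']]] := psd_spec hA'; have [V' [q' [hV' -> hq']]] := psd_spec hB'.
rewrite !tens_spec !supp_le_spec // => h h'.
rewrite !trentE //; try exact: tens_unitary.
rewrite !tr_spec // !ReC_r2c.
transitivity (\sum_i \sum_i' \sum_j \sum_j'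
   ((weight U V i j * (p 0 i * (lnp (p 0 i) - lnp (q 0 j)))) *
      (weight U' V' i' j' * p' 0 i') +
    (weight U V i j * p 0 i) *
      (weight U' V' i' j' * (p' 0 i' * (lnp (p' 0 i') - lnp (q' 0 j')))))).
  rewrite mxtens_sum; apply: eq_bigr => i _; apply: eq_bigr => i' _.
  rewrite mxtens_sum; apply: eq_bigr => j _; apply: eq_bigr => j' _.
  rewrite tens_weight !tens_rowE.
  (* Terms with a zero weight or a zero [p] vanish on both sides. For the others the support
     conditions make [q] and [q'] positive, and the logarithm is additive. *)
  have [w0|w0] := eqVneq (weight U V i j) 0; first by rewrite w0 !mul0r addr0.
  have [w0'|w0'] := eqVneq (weight U' V' i' j') 0; first by rewrite w0' !(mul0r, mulr0) addr0.
  have := hp i; rewrite le_eqVlt => /predU1P[<-|pi]; first by rewrite !(mul0r, mulr0) addr0.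
  have := hp' i'; rewrite le_eqVlt => /predU1P[<-|pi']; first by rewrite !(mul0r, mulr0) addr0.
  have qj : 0 < q 0 j.
    by rewrite lt_def hq andbT; apply: contra w0 => /eqP qj; rewrite h // gt_eqF.
  have qj' : 0 < q' 0 j'.
    by rewrite lt_def hq' andbT; apply: contra w0' => /eqP qj'; rewrite h' // gt_eqF.
  rewrite /lnp !mulr_gt0 // pi pi' qj qj' !lnM ?posrE //; ring.
have fact (F : 'I_m -> 'I_m -> R) (G : 'I_n -> 'I_n -> R) :
    \sum_i \sum_i' \sum_j \sum_j' F i j * G i' j' =
    (\sum_i \sum_j F i j) * (\sum_i' \sum_j' G i' j').
  rewrite mulr_suml; apply: eq_bigr => i _; rewrite mulr_sumr; apply: eq_bigr => i' _.
  by rewrite mulr_suml; apply: eq_bigr => j _; rewrite mulr_sumr.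
under eq_bigr => i _ do under eq_bigr => i' _ do under eq_bigr => j _ do rewrite big_split.
under eq_bigr => i _ do under eq_bigr => i' _ do rewrite big_split.
under eq_bigr => i _ do rewrite big_split.
rewrite big_split /= (fact (fun i j => weight U V i j * _)).
rewrite (fact (fun i j => weight U V i j * p 0 i)); congr (_ * _ + _ * _).
  by apply: eq_bigr => i _; rewrite -mulr_suml weight_row // mul1r.
by apply: eq_bigr => i _; rewrite -mulr_suml weight_row // mul1r.
Qed.

End TensorEntropy.

Lemma tpowM d (A B : 'M[C]_d) n : tpow (A *m B) n = tpow A n *m tpow B n.
Proof.
elim: n => [|n IH] /=; rewrite castmx_mulmx; first by rewrite mulmx1.
by rewrite tensmx_mul IH.
Qed.

Lemma tpow_adj d (A : 'M[C]_d) n : adjmx (tpow A n) = tpow (adjmx A) n.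
Proof.
elim: n => [|n IH] /=; rewrite castmx_adj; first by rewrite adjmx1.
by rewrite tens_adj IH.
Qed.

Lemma tpow1 d n : tpow (1%:M : 'M[C]_d) n = 1%:M.
Proof.
elim: n => [|n IH] /=; first by rewrite castmx_one.
by rewrite IH tens_one castmx_one.
Qed.

Lemma tpow_tr d (A : 'M[C]_d) n : \tr (tpow A n) = \tr A ^+ n.
Proof.
elim: n => [|n IH] /=; rewrite castmx_tr; first by rewrite mxtrace1 expr0.
by rewrite tens_tr IH exprS.
Qed.

Lemma psd1 n : psd (1%:M : 'M[C]_n).
Proof.
have h1 : unitarymx' (1%:M : 'M[C]_n) by rewrite /unitarymx' mul1mx adjmx1.
by rewrite -(spec_const1 h1); apply: spec_psd => i; rewrite mxE ler01.
Qed.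

Lemma tpow_psd d (A : 'M[C]_d) n : psd A -> psd (tpow A n).
Proof.
move=> hA; elim: n => [|n IH] /=; apply: castmx_psd; first exact: psd1.
exact: tens_psd.
Qed.

Lemma tpow_unitary d (U : 'M[C]_d) n : unitarymx' U -> unitarymx' (tpow U n).
Proof. by move=> h; rewrite /unitarymx' tpow_adj -tpowM (h : U *m _ = _) tpow1. Qed.

Lemma tpow_relent d (A B : 'M[C]_d) n : density A -> psd B -> supp_le A B ->
  supp_le (tpow A n) (tpow B n) /\ trent (tpow A n) (tpow B n) = n%:R * trent A B.
Proof.
move=> [hA trA] hB h; elim: n => [|n [IH1 IH2]] /=.
  split; first by move=> v.
  by rewrite mul0r /trent subrr mulmx0 mxtrace0.
split; first by apply/castmx_supp_le; apply: tens_supp_le => //; exact: tpow_psd.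
rewrite castmx_trent tens_trent //; try exact: tpow_psd.
by rewrite tpow_tr trA expr1n IH2 -natr1 /=; ring.
Qed.

(** The exponent is a successor because zeroth powers are the identity, for which the inclusion
    always holds. *)
Lemma tpow_supp_leI d (A B : 'M[C]_d) n : density A -> psd B ->
  supp_le (tpow A n.+1) (tpow B n.+1) -> supp_le A B.
Proof.
move=> [hA trA] hB /= /castmx_supp_le; apply: tens_supp_leI => //; try exact: tpow_psd.
by rewrite tpow_tr trA expr1n.
Qed.

End TensorPowers.

(** * The invariant state that dominates a tensor power up to a polynomial factor *)

Section UniversalState.
Variable R : realType.
Local Notation C := (R[i]).
Local Notation r2c := (real_complex R).

(** The exponents depend only on the position and are at most [n], which bounds the number of
    distinct monomials. The same form yields the continuity of the tensor powers of the
    representation. *)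
Lemma tpow_monomial d n : exists c : 'I_(d ^ n) -> 'I_(d ^ n) ->
    {ffun 'I_d * 'I_d -> 'I_n.+1},
  forall (A : 'M[C]_d) i j, tpow A n i j = \prod_k A k.1 k.2 ^+ c i j k.
Proof.
elim: n => [|n [c IH]].
  exists (fun _ _ => [ffun=> ord0]) => A i j /=.
  rewrite castmxE [LHS]mxE /= big1 => [|k _]; last by rewrite ffunE.
  by rewrite !ord1.
pose h (i : 'I_(d ^ n.+1)) := mxtens_unindex (cast_ord (expnS d n) i).
exists (fun i j => [ffun k => inord (c (h i).2 (h j).2 k + (k == ((h i).1, (h j).1)))]).
move=> A i j /=; rewrite castmxE [LHS]mxE /= !esymK.
transitivity (A (h i).1 (h j).1 * tpow A n (h i).2 (h j).2); first by [].
rewrite IH [RHS](eq_bigr (fun k => A k.1 k.2 ^+ (k == ((h i).1, (h j).1)) *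
   A k.1 k.2 ^+ c (h i).2 (h j).2 k)).
  rewrite big_split /=; congr (_ * _); rewrite (bigD1 ((h i).1, (h j).1)) //= eqxx.
  by rewrite big1 ?mulr1 // => k /negbTE ->.
move=> k _; rewrite ffunE inordK ?exprD 1?mulrC //.
by rewrite -[n.+2]addn1 -addSn leq_add ?leq_b1 // ltn_ord.
Qed.

Definition tpow_span d n : set 'M[C]_(d ^ n) :=
  [set x | exists s : seq (C * 'M[C]_d), x = \sum_(z <- s) z.1 *: tpow z.2 n].

Arguments tpow_span : clear implicits.

Lemma tpow_span_tpow d n (A : 'M[C]_d) : tpow_span d n (tpow A n).
Proof. by exists [:: (1, A)]; rewrite big_seq1 scale1r. Qed.

Lemma tpow_span_lin d n : lin_closed (tpow_span d n).
Proof.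
split; first by exists [::]; rewrite big_nil.
move=> a x y [s ->] [t ->]; exists ([seq (a * z.1, z.2) | z <- s] ++ t).
rewrite big_cat big_map scaler_sumr; congr (_ + _).
by apply: eq_bigr => z _; rewrite scalerA.
Qed.

Lemma tpow_spanM d n (A : 'M[C]_d) x : tpow_span d n x -> tpow_span d n (tpow A n *m x).
Proof.
move=> [s ->]; exists [seq (z.1, A *m z.2) | z <- s].
rewrite big_map mulmx_sumr; apply: eq_bigr => z _.
by rewrite -scalemxAr tpowM.
Qed.

(** Grouping the positions by their monomial writes a tensor power as a combination of the 0/1
    matrices [I m], one for each exponent function. *)
Lemma tpow_span_dim d n : exists S : 'M[C]_(n.+1 ^ (d * d), d ^ n * d ^ n),
  forall x, tpow_span d n x -> (mxvec x <= S)%MS.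
Proof.
have [c hc] := tpow_monomial d n.
have eD : #|{ffun 'I_d * 'I_d -> 'I_n.+1}| = (n.+1 ^ (d * d))%N.
  by rewrite card_ffun card_ord card_prod card_ord.
rewrite -eD; pose I m : 'M[C]_(d ^ n) := \matrix_(i, j) (c i j == m)%:R.
exists (\matrix_k mxvec (I (enum_val k))) => x [s ->].
rewrite linear_sum; apply: summx_sub => -[a A] _ /=; rewrite linearZ scalemx_sub //.
have -> : tpow A n = \sum_(m : {ffun 'I_d * 'I_d -> 'I_n.+1}) (\prod_k A k.1 k.2 ^+ (m k)) *: I m.
  apply/matrixP => i j; rewrite hc summxE (bigD1 (c i j)) //= !mxE eqxx mulr1.
  rewrite [X in _ + X]big1 ?addr0 // => m neq; rewrite !mxE eq_sym (negbTE neq) mulr0 //.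
rewrite linear_sum; apply: summx_sub => m _ /=; rewrite linearZ scalemx_sub //.
by apply/(submx_trans _ (row_sub (enum_rank m) _)); rewrite rowK enum_rankK.
Qed.

(** The factor is the square root of [rho]. Its tensor power lies in the span, so
    [orthonormal_square_sum] applies to it. *)
Lemma density_factor d (rho : 'M[C]_d) : psd rho ->
  exists v : 'M[C]_d, v *m adjmx v = rho.
Proof.
move=> /psd_spec [U [p [hU -> hp]]]; exists (spec U (map_mx Num.sqrt p)).
rewrite adjmx_spec specM //; congr (spec _ _); apply/matrixP => i j.
by rewrite !mxE ord1 -expr2 sqr_sqrtr.
Qed.

(* The dominating state is proportional to the square sum of an orthonormal
   basis of the span of all tensor powers, mixed with the maximally mixed
   state so that it is invertible. *)
Lemma universal_state d n (rho : 'M[C]_d) : density rho ->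
  exists (W : 'M[C]_(d ^ n)) (q : 'rV[R]_(d ^ n)) (K : R),
  [/\ unitarymx' W /\ (forall i, 0 < q 0 i), \tr (spec W q) = 1,
      forall A : 'M[C]_d, tpow A n *m spec W q = spec W q *m tpow A n,
      0 < K <= 2 * (n.+1)%:R ^+ (d * d) &
      forall x, quad (tpow rho n) x <= K * quad (spec W q) x].
Proof.
move=> [hrho tr1].
have [S hS] := tpow_span_dim d n.
have [k [M [kD trM hM comM domM]]] := orthonormal_square_sum (tpow_span_lin d n) hS.
have [v0 ev0] := density_factor hrho.
pose v := tpow v0 n; have ev : v *m adjmx v = tpow rho n.
  by rewrite /v tpow_adj -tpowM ev0.
have trr : \tr (tpow rho n) = 1 by rewrite tpow_tr tr1 expr1n.
have dom x : quad (tpow rho n) x <= quad M x.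
  by rewrite -ev; apply: domM; [exact: tpow_span_tpow|rewrite ev].
have d0 : (0 < d ^ n)%N.
  rewrite lt0n; apply/negP => /eqP e; move: (tpow rho n) trr; rewrite e => r.
  by rewrite /mxtrace big_ord0 => /esym/eqP; rewrite oner_eq0.
have [W [m [hW eM hm]]] := psd_spec hM.
have trm : \sum_i m 0 i = k%:R.
  by apply: (@complexI R); rewrite -(tr_spec m hW) -eM trM rmorph_nat.
(* Otherwise [M] is positive with trace 0, hence 0; tested on eigenvectors, the domination then
   forces the tensor power of [rho] to have trace 0 instead of 1. *)
have k0 : (0 < k)%N.
  rewrite lt0n; apply/negP => /eqP k0; move: trm; rewrite k0 => /eqP.
  rewrite psumr_eq0 // => /allP m0; have M0 : M = 0.
    rewrite eM (_ : m = 0) ?/spec.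
      rewrite (_ : cdiag 0 = 0) ?mulmx0 ?mul0mx //.
      by apply/matrixP => i j; rewrite cdiagE !mxE mul0rn.
    apply/matrixP => i j; rewrite ord1 mxE; apply/eqP.
    by apply: (m0 j); rewrite mem_index_enum.
  have [U [p [hU er hp]]] := psd_spec (tpow_psd n hrho).
  have p0 i : p 0 i = 0.
    apply/eqP; rewrite eq_le hp andbT.
    have := dom (U *m delta_mx i 0); rewrite er quadE M0 /quad mulmx0 mul0mx.
    rewrite mulmxA unitarymx_adj // mul1mx mxE (bigD1 i) //= big1 => [|j ji].
      by rewrite !mxE !eqxx /sqn /= expr1n expr0n addr0 addr0 mulr1.
    by rewrite mxE (negbTE ji) /= /sqn /= expr0n addr0 mulr0.
  move: trr; rewrite er tr_spec // big1 // => /esym/eqP.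
  by rewrite oner_eq0.
(* The multiple [b] of the identity has trace [k], as [M] does, so [a] normalizes their sum and the
   factor of domination is [2 * k]. *)
pose a : R := (2 * k%:R)^-1; pose b : R := k%:R / (d ^ n)%:R.
have kR : 0 < k%:R :> R by rewrite ltr0n.
have a0 : 0 < a by rewrite invr_gt0 mulr_gt0.
have b0 : 0 < b by rewrite divr_gt0 // ltr0n.
pose q := a *: (m + b *: const_mx 1).
have eq : spec W q = r2c a *: (M + r2c b *: 1%:M).
  by rewrite /q specZ specD specZ spec_const1 // eM.
exists W, q, (2 * k%:R); split.
- split=> // i; rewrite !mxE mulr1 mulr_gt0 //; exact: ltr_wpDl.
- rewrite eq linearZ /= linearD /= linearZ /= mxtrace1 trM.
  rewrite -[k%:R](rmorph_nat r2c) -[(d ^ n)%:R](rmorph_nat r2c) -rmorphM -rmorphD -rmorphM.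
  rewrite /a /b (_ : _ * _ = 1) ?rmorph1 //; field.
  by rewrite !gt_eqF // ltr0n.
- move=> A; rewrite eq -scalemxAr -scalemxAl mulmxDr mulmxDl.
  rewrite -scalemxAr -scalemxAl mulmx1 mul1mx comM //.
    exact: tpow_spanM.
  by rewrite tpow_adj; exact: tpow_spanM.
- rewrite mulr_gt0 //= ler_wpM2l // -natrX ler_nat //.
move=> x; apply: le_trans (dom x) _; rewrite eM.
rewrite !quadE mulr_sumr; apply: ler_sum => i _.
rewrite mulrA ler_wpM2r ?sqn_ge0 // !mxE mulr1 mulrA divff ?mul1r; last first.
  by rewrite mulf_neq0 // gt_eqF.
by rewrite lerDl ltW.
Qed.

End UniversalState.

(** * Haar averages, and the twirl as restriction to the commutant *)

Section Twirling.
Variables (R : realType) (G : ptopologicalType) (mul : G -> G -> G)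
  (inv : G -> G) (e : G) (mu : {measure set borelG G -> \bar R}).
Local Notation C := (R[i]).
Local Notation r2c := (real_complex R).
Hypotheses (hG : compact_group mul inv e) (hmu : haar_prob mul mu).

Definition ccont (f : G -> C) : Prop :=
  continuous (fun g => complex.Re (f g)) /\ continuous (fun g => complex.Im (f g)).

Lemma ImCD (x y : C) : complex.Im (x + y) = complex.Im x + complex.Im y.
Proof. by case: x; case: y. Qed.

Lemma ReCM (x y : C) : complex.Re (x * y) =
  complex.Re x * complex.Re y - complex.Im x * complex.Im y.
Proof. by case: x; case: y. Qed.

Lemma ImCM (x y : C) : complex.Im (x * y) =
  complex.Re x * complex.Im y + complex.Im x * complex.Re y.
Proof. by case: x; case: y. Qed.

Lemma ccont_cst (a : C) : ccont (fun=> a).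
Proof. by split; exact: cst_continuous. Qed.

Lemma ccontD f g : ccont f -> ccont g -> ccont (fun x => f x + g x).
Proof.
move=> [f1 f2] [g1 g2]; split=> x.
  under eq_fun do rewrite ReCD; exact: cvgD (f1 x) (g1 x).
under eq_fun do rewrite ImCD; exact: cvgD (f2 x) (g2 x).
Qed.

Lemma ccontM f g : ccont f -> ccont g -> ccont (fun x => f x * g x).
Proof.
move=> [f1 f2] [g1 g2]; split=> x.
  under eq_fun do rewrite ReCM.
  exact: cvgB (cvgM (f1 x) (g1 x)) (cvgM (f2 x) (g2 x)).
under eq_fun do rewrite ImCM.
exact: cvgD (cvgM (f1 x) (g2 x)) (cvgM (f2 x) (g1 x)).
Qed.

Lemma ccont_conj f : ccont f -> ccont (fun x => Num.conj (f x)).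
Proof.
move=> [f1 f2]; split=> x.
  by under eq_fun do rewrite ReC_conj; exact: f1.
rewrite (_ : (fun _ => _) = (fun y => - complex.Im (f y))); last first.
  by apply/funext => y; case: (f y).
exact: cvgN (f2 x).
Qed.

Lemma ccont_sum I (s : seq I) (P : pred I) (f : I -> G -> C) :
  (forall i, ccont (f i)) -> ccont (fun x => \sum_(i <- s | P i) f i x).
Proof.
move=> h; elim: s => [|i s IH].
  by under eq_fun do rewrite big_nil; exact: ccont_cst.
under eq_fun do rewrite big_cons.
by case: (P i) => //; exact: ccontD.
Qed.

Lemma ccont_prod I (s : seq I) (f : I -> G -> C) :
  (forall i, ccont (f i)) -> ccont (fun x => \prod_(i <- s) f i x).
Proof.
move=> h; elim: s => [|i s IH].
  by under eq_fun do rewrite big_nil; exact: ccont_cst.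
by under eq_fun do rewrite big_cons; exact: ccontM.
Qed.

Lemma ccontX f n : ccont f -> ccont (fun x => f x ^+ n).
Proof.
move=> h; elim: n => [|n IH]; first exact: ccont_cst.
by under eq_fun do rewrite exprS; exact: ccontM.
Qed.

Lemma continuous_borel_measurable (f : G -> R) : continuous f ->
  measurable_fun [set: borelG G] (f : borelG G -> R).
Proof.
move=> /continuousP cf; apply: (measurability _ (RGenOpens.measurableE R)).
move=> _ [_ [a [b ->] <-]]; rewrite setTI; apply: sub_sigma_algebra.
exact/cf/interval_open.
Qed.

Lemma continuous_haar_integrable (f : G -> R) : continuous f ->
  mu.-integrable [set: borelG G] (EFin \o (f : borelG G -> R)).
Proof.
move=> cf; apply: measurable_bounded_integrable => //.
- by rewrite hmu.1 ltry.
- exact: continuous_borel_measurable.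
have cfT : {within [set: G], continuous f} by apply: continuous_subspaceT.
have /compact_bounded[M [_ mrt]] := continuous_compact cfT (cg_compact hG).
by exists M; split; rewrite ?num_real // => y My g _; apply: mrt => //; exists g.
Qed.

Lemma translation_continuous g : continuous (mul g).
Proof.
move=> x; apply: (@continuous_comp _ _ _ (fun y => (g, y)) (fun p => mul p.1 p.2)).
  by apply: cvg_pair => //=; exact: cvg_cst.
exact: (cg_mul_cont hG).
Qed.

Lemma translation_measurable g :
  measurable_fun [set: borelG G] (mul g : borelG G -> borelG G).
Proof.
apply: (@measurability _ _ (borelG G) (borelG G) setT (mul g) (@open G) erefl).
move=> _ [A oA <-]; rewrite setTI; apply: sub_sigma_algebra.
by have /continuousP := @translation_continuous g; exact.
Qed.

(** Invariance is assumed for images; the preimage under translation by [g] is the image under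
    translation by [inv g]. *)
Lemma haar_preimage g (A : set (borelG G)) : measurable A -> mu (mul g @^-1` A) = mu A.
Proof.
move=> mA; rewrite -(hmu.2 (inv g) A mA); congr (mu _).
apply/seteqP; split=> x /=.
  by move=> Ax; exists (mul g x) => //; rewrite (cg_assoc hG) (cg_inv hG g).1 (cg_unit hG x).1.
by move=> [y Ay <-]; rewrite (cg_assoc hG) (cg_inv hG g).2 (cg_unit hG y).1.
Qed.

Lemma Rintegral_translation g (f : G -> R) : continuous f ->
  (\int[mu]_x (f (mul g x)))%R = (\int[mu]_x f x)%R.
Proof.
move=> cf; rewrite /Rintegral; congr fine.
have mf := continuous_borel_measurable cf.
have mg := translation_measurable g.
have cfg : continuous (fun x => f (mul g x)).
  move=> x; apply: (@continuous_comp _ _ _ (mul g) f); last exact: cf.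
  exact: translation_continuous.
transitivity (\int[pushforward mu (mul g : borelG G -> borelG G)]_y (f y)%:E)%E.
  rewrite (@integral_pushforward _ _ (borelG G) (borelG G) R (mul g) mg mu setT (EFin \o f)) //.
  - exact/measurable_EFinP.
  - rewrite preimage_setT; exact: (continuous_haar_integrable cfg).
by apply: eq_measure_integral => A mA _; exact: haar_preimage.
Qed.

Lemma cintegralD f g : ccont f -> ccont g ->
  cintegral mu (fun x => f x + g x) = cintegral mu f + cintegral mu g.
Proof.
move=> [f1 f2] [g1 g2]; rewrite /cintegral.
under eq_Rintegral do rewrite ReCD.
under [X in (_ +i* X)%C]eq_Rintegral do rewrite ImCD.
by rewrite !RintegralD //; exact: continuous_haar_integrable.
Qed.

Lemma cintegralZ a f : ccont f ->
  cintegral mu (fun x => a * f x) = a * cintegral mu f.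
Proof.
move=> [f1 f2]; have i1 := continuous_haar_integrable f1.
have i2 := continuous_haar_integrable f2.
have c1 (k : R) : continuous (fun g => k * complex.Re (f g)).
  by move=> x; apply: cvgM; [exact: cvg_cst|exact: f1].
have c2 (k : R) : continuous (fun g => k * complex.Im (f g)).
  by move=> x; apply: cvgM; [exact: cvg_cst|exact: f2].
rewrite /cintegral.
under eq_Rintegral do rewrite ReCM.
under [X in (_ +i* X)%C]eq_Rintegral do rewrite ImCM.
rewrite RintegralB //; try exact: continuous_haar_integrable.
rewrite RintegralD //; try exact: continuous_haar_integrable.
by rewrite !RintegralZl //; case: a.
Qed.

Lemma cintegral_cst a : cintegral mu (fun=> a) = a.
Proof.
rewrite /cintegral !Rintegral_cst // hmu.1 /= !mulr1.
by case: a.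
Qed.

Lemma cintegral_sum I (s : seq I) (f : I -> G -> C) : (forall i, ccont (f i)) ->
  cintegral mu (fun x => \sum_(i <- s) f i x) = \sum_(i <- s) cintegral mu (f i).
Proof.
move=> h; elim: s => [|i s IH].
  by rewrite big_nil; under eq_fun do rewrite big_nil; exact: cintegral_cst.
rewrite big_cons -IH -cintegralD //; last exact: ccont_sum.
by congr (cintegral mu _); apply/funext => x; rewrite big_cons.
Qed.

Lemma cintegral_translation g f : ccont f ->
  cintegral mu (fun x => f (mul g x)) = cintegral mu f.
Proof.
move=> [f1 f2]; rewrite /cintegral; congr (_ +i* _)%C.
  exact: (Rintegral_translation g f1).
exact: (Rintegral_translation g f2).
Qed.

Definition mxintegral m n (F : G -> 'M[C]_(m, n)) : 'M[C]_(m, n) :=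
  \matrix_(i, j) cintegral mu (fun g => F g i j).

Lemma ccont_mulmx m n p (F : G -> 'M[C]_(m, n)) (H : G -> 'M[C]_(n, p)) :
  (forall i j, ccont (fun g => F g i j)) -> (forall i j, ccont (fun g => H g i j)) ->
  forall i j, ccont (fun g => (F g *m H g) i j).
Proof.
move=> hF hH i j; under eq_fun do rewrite mxE.
by apply: ccont_sum => k; exact: ccontM.
Qed.

Lemma mxintegral_mulr m n p (F : G -> 'M[C]_(m, n)) (A : 'M[C]_(n, p)) :
  (forall i j, ccont (fun g => F g i j)) ->
  mxintegral F *m A = mxintegral (fun g => F g *m A).
Proof.
move=> hF; apply/matrixP => i j; rewrite !mxE.
have -> : (fun g => (F g *m A) i j) = (fun g => \sum_k A k j * F g i k).
  by apply/funext => g; rewrite mxE; apply: eq_bigr => k _; rewrite mulrC.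
rewrite cintegral_sum => [|k]; last by apply: ccontM => //; exact: ccont_cst.
by apply: eq_bigr => k _; rewrite mxE cintegralZ // mulrC.
Qed.

Lemma mxintegral_mull m n p (F : G -> 'M[C]_(m, n)) (A : 'M[C]_(p, m)) :
  (forall i j, ccont (fun g => F g i j)) ->
  A *m mxintegral F = mxintegral (fun g => A *m F g).
Proof.
move=> hF; apply/matrixP => i j; rewrite !mxE.
have -> : (fun g => (A *m F g) i j) = (fun g => \sum_k A i k * F g k j).
  by apply/funext => g; rewrite mxE.
rewrite cintegral_sum => [|k]; last by apply: ccontM => //; exact: ccont_cst.
by apply: eq_bigr => k _; rewrite mxE cintegralZ.
Qed.

Lemma tr_mxintegral n (F : G -> 'M[C]_n) :
  (forall i j, ccont (fun g => F g i j)) ->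
  \tr (mxintegral F) = cintegral mu (fun g => \tr (F g)).
Proof.
by move=> hF; rewrite cintegral_sum //; apply: eq_bigr => i _; rewrite mxE.
Qed.

Lemma mxintegral_cst m n (A : 'M[C]_(m, n)) : mxintegral (fun=> A) = A.
Proof. by apply/matrixP => i j; rewrite mxE cintegral_cst. Qed.

Lemma mxintegral_translation m n g (F : G -> 'M[C]_(m, n)) :
  (forall i j, ccont (fun g => F g i j)) ->
  mxintegral (fun h => F (mul g h)) = mxintegral F.
Proof.
move=> hF; apply/matrixP => i j; rewrite !mxE.
exact: (cintegral_translation g (hF i j)).
Qed.

Variables (d : nat) (u : G -> 'M[C]_d).
Hypothesis hu : cont_unitary_rep mul e u.
Variable n : nat.

Let un g := tpow (u g) n.

Lemma rep_tpow_unitary g : unitarymx' (un g).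
Proof. by apply: tpow_unitary; case: hu. Qed.

Lemma rep_tpowM g h : un (mul g h) = un g *m un h.
Proof. by rewrite /un -tpowM; case: hu => _ _ -> _. Qed.

Lemma rep_tpow_ccont i j : ccont (fun g => un g i j).
Proof.
have [c hc] := tpow_monomial R d n; case: hu => _ _ _ hcont.
under eq_fun do rewrite /un hc.
apply: ccont_prod => k; apply: ccontX; exact: hcont.
Qed.

Lemma conj_rep_ccont X i j : ccont (fun g => (un g *m X *m adjmx (un g)) i j).
Proof.
apply: ccont_mulmx => [k l|k l].
  apply: ccont_mulmx => [k' l'|k' l']; first exact: rep_tpow_ccont.
  exact: ccont_cst.
under eq_fun do rewrite adjmxE; apply: ccont_conj; exact: rep_tpow_ccont.
Qed.

Lemma twirlE X : twirl mu u X = mxintegral (fun g => un g *m X *m adjmx (un g)).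
Proof. by []. Qed.

(** Conjugation by [un g] translates the integrand, which leaves the Haar integral unchanged;
    unitarity turns invariance under conjugation into commutation. *)
Lemma twirl_commutant X : commutant u n (twirl mu u X).
Proof.
move=> g; rewrite -/(un g).
have h : un g *m twirl mu u X *m adjmx (un g) = twirl mu u X.
  rewrite twirlE mxintegral_mull ?mxintegral_mulr; first last.
  - exact: conj_rep_ccont.
  - by apply: ccont_mulmx => i j; [exact: ccont_cst|exact: conj_rep_ccont].
  rewrite -[RHS](mxintegral_translation g); last exact: conj_rep_ccont.
  congr mxintegral; apply/funext => h; rewrite rep_tpowM adjmxM.
  by rewrite !mulmxA.
rewrite -[in LHS]h -!mulmxA unitarymx_adj ?mulmx1 //; exact: rep_tpow_unitary.
Qed.

(** By cyclicity the unitaries can be moved past [A] and cancel, so the integrand is constant and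
    the total mass is 1. *)
Lemma twirl_tr X A : commutant u n A -> \tr (twirl mu u X *m A) = \tr (X *m A).
Proof.
move=> hA; rewrite twirlE mxintegral_mulr; last exact: conj_rep_ccont.
rewrite tr_mxintegral; last first.
  by apply: ccont_mulmx => i j; [exact: conj_rep_ccont|exact: ccont_cst].
rewrite -[RHS]cintegral_cst; congr (cintegral mu _); apply/funext => g.
rewrite -!mulmxA mxtrace_mulC -!mulmxA.
have := hA g; rewrite -/(un g) => ->.
by rewrite (mulmxA (adjmx _)) unitarymx_adj ?mul1mx //; exact: rep_tpow_unitary.
Qed.

Lemma commutant_star_subalg : star_subalg (commutant u n).
Proof.
split=> [g|a x y hx hy g|x y hx hy g|x hx g].
- by rewrite mul1mx mulmx1.
- by rewrite mulmxDl mulmxDr -scalemxAl -scalemxAr hx hy.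
- by rewrite -mulmxA hy mulmxA hx mulmxA.
have hU := rep_tpow_unitary g; have := hx g; rewrite -/(un g) => ex.
have : adjmx (un g) *m adjmx x = adjmx x *m adjmx (un g) by rewrite -!adjmxM ex.
move=> /(congr1 (fun z => un g *m z *m un g)); rewrite !mulmxA.
rewrite (hU : un g *m _ = _) mul1mx => ->.
by rewrite -!mulmxA unitarymx_adj // mulmx1.
Qed.

Lemma twirl_restr_density X : twirl mu u X = restr_density (commutant u n) X.
Proof.
apply: restr_density_unique; first exact: commutant_star_subalg.
  exact: twirl_commutant.
by move=> b hb; exact: twirl_tr.
Qed.

End Twirling.

(** * Bounds for restricted states, the abelian subalgebra, and the limits *)

Section Assembly.
Variable R : realType.
Local Notation C := (R[i]).
Local Notation r2c := (real_complex R).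

Section RestrictedBounds.
Variables (N : nat) (B : set 'M[C]_N) (r s : 'M[C]_N).
Hypotheses (hB : star_subalg B) (hr : density r) (hs : psd s).

Lemma relent_restr_le : supp_le r s -> (relent_restr B r s <= (trent r s)%:E)%E.
Proof.
move=> h; rewrite /relent_restr relentE; last exact: supp_le_restr hr.1 hs h.
by rewrite lee_fin; exact: trent_restr_le hr.1 hs h.
Qed.

(** The kernel projection of [s] lies in [B], so the restriction of [r] has the same nonzero trace
    against it as [r]. *)
Lemma relent_restr_pinfty : B s -> ~ supp_le r s -> relent_restr B r s = +oo%E.
Proof.
move=> Bs h; rewrite /relent_restr (restr_density_id hB Bs) relent_pinfty // => h'.
apply: h; apply/(supp_le_kerproj hr.1 hs.1).
have [_ <-] := restr_densityP hB r; last first.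
  by apply: mxalg_mxfun => //; [exact: star_subalg_mxalg|exact: hs.1].
by apply/(supp_le_kerproj (restr_density_psd hB hr.1) hs.1).
Qed.

(** The logarithms of [s] and of the dominating state lie in [B], so the restricted density has the
    traces against them that [trent_lower] asks for. *)
Lemma relent_restr_ge (W : 'M[C]_N) (q : 'rV[R]_N) (K : R) :
  supp_le r s -> B s -> B (spec W q) -> unitarymx' W -> (forall i, 0 < q 0 i) ->
  \tr (spec W q) = 1 -> 0 < K ->
  (forall x, quad r x <= K * quad (spec W q) x) ->
  ((trent r s - ln K)%:E <= relent_restr B r s)%E.
Proof.
move=> h Bs BT hW hq trT K0 dom.
rewrite /relent_restr relentE; last exact: supp_le_restr hr.1 hs h.
rewrite (restr_density_id hB Bs) lee_fin.
have hA := star_subalg_mxalg hB; have [_ eD] := restr_densityP hB r.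
apply: (@trent_lower _ _ r s _ (spec W q)).
- by apply: eD; apply: mxalg_mxfun => //; exact: adjmx_spec.
- by apply: eD; apply: mxalg_mxfun => //; exact: hs.1.
- have := tr_restr_density hB r; rewrite hr.2.
  have [U [p [hU -> hp]]] := psd_spec (restr_density_psd hB hr.1).
  by move=> trD; apply: trent_ge0 => //; rewrite trD trT.
have [U [p [hU er hp]]] := psd_spec hr.1.
by have := dom; have := hr.2; rewrite er => tr1 dom'; exact: trent_le_ln.
Qed.

End RestrictedBounds.

Definition bicommutant2 N (S T : 'M[C]_N) : set 'M[C]_N :=
  [set X | forall Y, Y *m S = S *m Y -> Y *m T = T *m Y -> X *m Y = Y *m X].

(** Since [S] and [T] commute, every [Y] in the bicommutant commutes with both, and is therefore
    among the matrices with which each [X] in it must commute. The inclusion in [A] holds because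
    the [V i] commute with [S] and [T]. *)
Lemma bicommutant2_abelian N (S T : 'M[C]_N) (A : set 'M[C]_N) (I : Type)
    (V : I -> 'M[C]_N) :
  adjmx S = S -> adjmx T = T -> S *m T = T *m S ->
  (forall i, V i *m S = S *m V i) -> (forall i, V i *m T = T *m V i) ->
  A = [set X | forall i, X *m V i = V i *m X] ->
  abelian_subalg_of A (bicommutant2 S T).
Proof.
move=> hS hT hST VS VT ->; split=> [|X hX i|X Y hX hY].
- split=> [Y _ _|a x y hx hy Y YS YT|x y hx hy Y YS YT|x hx Y YS YT].
  + by rewrite mul1mx mulmx1.
  + by rewrite mulmxDl mulmxDr -scalemxAl -scalemxAr hx // hy.
  + by rewrite -mulmxA hy // mulmxA hx // mulmxA.
  have e : x *m adjmx Y = adjmx Y *m x.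
    apply: hx; first by rewrite -{1}hS -adjmxM -YS adjmxM hS.
    by rewrite -{1}hT -adjmxM -YT adjmxM hT.
  by have := congr1 (@adjmx R N N) e; rewrite !adjmxM !adjmxK => ->.
- exact: hX.
by apply: hX; apply: hY.
Qed.

(** With [y] the square root of [n + 1], the bounds [n + 2 <= 2 y^2] and [ln y <= y] give
    [ln K <= c y], and division by [y^2] leaves [c / y]. The sequence serves all admissible [K] at
    once. *)
Lemma ln_poly_small (D : nat) : exists eps : nat -> R,
  eps n @[n --> \oo] --> (0 : R) /\
  forall n (K : R), 0 < K <= 2 * (n.+2)%:R ^+ D -> (n.+1)%:R^-1 * ln K <= eps n.
Proof.
pose c : R := ln 2 + D%:R * (ln 2 + 2).
exists (fun n => c * Num.sqrt (harmonic n)); split.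
  rewrite -[X in _ --> X](mulr0 c); apply: cvgMr.
  rewrite -[X in _ --> X](sqrtr0 R).
  exact: (cvg_comp _ _ (@cvg_harmonic R) (@sqrt_continuous R 0)).
move=> n K /andP[K0 Kle]; set y := Num.sqrt (n.+1)%:R : R.
have y1 : 1 <= y by rewrite -(sqrtr1 R) ler_wsqrtr // ler1n.
have y0 : 0 < y by rewrite (lt_le_trans ltr01).
have y2 : y ^+ 2 = (n.+1)%:R by rewrite sqr_sqrtr.
have l2 : 0 <= ln (2 : R) by rewrite ln_ge0 // ler1n.
have lny : ln (n.+2)%:R <= ln 2 + 2 * y.
  apply: (@le_trans _ _ (ln (2 * y ^+ 2))).
    rewrite ler_ln ?posrE ?mulr_gt0 ?exprn_gt0 ?ltr0n // y2 -natrM ler_nat.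
    by rewrite mul2n -addnn !addSn !ltnS addnS ltnS leq_addl.
  rewrite lnM ?posrE ?exprn_gt0 // lnXn // -[ln y *+ 2]mulr_natl lerD2l ler_wpM2l //.
  exact/ltW/ln_sublinear.
have lnK : ln K <= c * y.
  apply: (@le_trans _ _ (ln 2 + D%:R * (ln 2 + 2 * y))).
    apply: (@le_trans _ _ (ln (2 * (n.+2)%:R ^+ D))).
      by rewrite ler_ln ?posrE ?mulr_gt0 ?exprn_gt0 ?ltr0n.
    rewrite lnM ?posrE ?exprn_gt0 ?ltr0n // lnXn ?ltr0n // lerD2l -[_ *+ D]mulr_natl.
    by rewrite ler_wpM2l.
  have -> : c * y = ln 2 * y + D%:R * (ln 2 * y + 2 * y) by rewrite /c; ring.
  apply: lerD; first by rewrite ler_peMr.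
  by rewrite ler_wpM2l // lerD2r ler_peMr.
rewrite /harmonic sqrtrV // -/y -y2.
rewrite mulrC ler_pdivrMr ?exprn_gt0 //; apply: le_trans lnK _.
by rewrite expr2 mulrA divfK // gt_eqF.
Qed.

Lemma squeeze_rate (T : R) (x : nat -> \bar R) (eps : nat -> R) :
  eps n @[n --> \oo] --> (0 : R) ->
  (forall n, exists K, [/\ (n.+1)%:R^-1 * ln K <= eps n,
     (((n.+1)%:R * T - ln K)%:E <= x n)%E & (x n <= ((n.+1)%:R * T)%:E)%E]) ->
  (fun n => ((n.+1)%:R^-1)%:E * x n)%E @ \oo --> T%:E.
Proof.
move=> heps h.
apply: (@squeeze_cvge _ _ _ _ (fun n => (T - eps n)%:E) _ (fun=> T%:E)).
- apply: nearW => n; have [K [hK lo hi]] := h n.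
  have n0 : 0 < (n.+1)%:R^-1 :> R by rewrite invr_gt0 ltr0n.
  apply/andP; split.
    apply: (@le_trans _ _ (((n.+1)%:R^-1)%:E * ((n.+1)%:R * T - ln K)%:E)%E).
      by rewrite -EFinM lee_fin mulrBr mulrA mulVf // mul1r lerD2l lerN2.
    by rewrite lee_wpmul2l // lee_fin ltW.
  apply: (@le_trans _ _ (((n.+1)%:R^-1)%:E * ((n.+1)%:R * T)%:E)%E).
    by rewrite lee_wpmul2l // lee_fin ltW.
  by rewrite -EFinM mulrA mulVf // mul1r.
- apply: cvg_EFin; first exact: nearW.
  rewrite -[X in _ --> X]subr0; apply: cvgB => //; exact: cvg_cst.
exact: cvg_cst.
Qed.

End Assembly.

Theorem theorem5p1 (R : realType) (G : ptopologicalType)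
  (mul : G -> G -> G) (inv : G -> G) (e : G)
  (mu : {measure set borelG G -> \bar R})
  (d : nat) (u : G -> 'M[R[i]]_d) (rho0 rho1 : 'M[R[i]]_d) :
  compact_group mul inv e ->
  haar_prob mul mu ->
  cont_unitary_rep mul e u ->
  density rho0 -> density rho1 ->
  (forall g, rho1 *m u g = u g *m rho1) ->
  let rho_n (rho : 'M[R[i]]_d) (n : nat) := twirl mu u (tpow rho n) in
  ((fun n => ((n.+1)%:R^-1)%:E * relent (rho_n rho0 n.+1) (rho_n rho1 n.+1))%E
     @ \oo --> relent rho0 rho1)
  /\
  ((fun n => ((n.+1)%:R^-1)%:E *
      ereal_sup [set relent_restr B (rho_n rho0 n.+1) (rho_n rho1 n.+1)
                | B in abelian_subalg_of (commutant u n.+1)])%E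
     @ \oo --> relent rho0 rho1).
Proof.
move=> hG hmu hu h0 h1 hinv rho_n.
pose r n := tpow rho0 n.+1; pose s n := tpow rho1 n.+1.
have hr n : density (r n).
  by split; [exact: tpow_psd h0.1|rewrite /r tpow_tr h0.2 expr1n].
have hs n : psd (s n) by exact: tpow_psd h1.1.
have hA n : star_subalg (commutant u n) by exact: commutant_star_subalg hu n.
have As n : commutant u n.+1 (s n) by move=> g; rewrite /s -!tpowM hinv.
have twE n : relent (rho_n rho0 n.+1) (rho_n rho1 n.+1) =
    relent_restr (commutant u n.+1) (r n) (s n).
  by rewrite /rho_n !(twirl_restr_density hG hmu hu).
(* Inside the commutant a state and its twirl have the same traces, so the product states can
   replace the twirled ones. *)
have reE n B : abelian_subalg_of (commutant u n.+1) B ->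
    relent_restr B (rho_n rho0 n.+1) (rho_n rho1 n.+1) = relent_restr B (r n) (s n).
  case=> hB BA _.
  have rE rho : restr_density B (rho_n rho n.+1) = restr_density B (tpow rho n.+1).
    apply: (restr_density_eq hB) => b Bb.
    by apply: (twirl_tr hG hmu hu); exact: BA.
  exact: (congr2 (@relent R _) (rE rho0) (rE rho1)).
have univ n : exists (W : 'M[R[i]]_(d ^ n.+1)) (q : 'rV[R]_(d ^ n.+1)) (K : R),
    [/\ [/\ unitarymx' W, (forall i, 0 < q 0 i) & \tr (spec W q) = 1],
      commutant u n.+1 (spec W q), 0 < K <= 2 * (n.+2)%:R ^+ (d * d),
      forall x, quad (r n) x <= K * quad (spec W q) x &
      exists2 B, abelian_subalg_of (commutant u n.+1) B & B (s n) /\ B (spec W q)].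
  have [W [q [K [[hW hq] tr1 com K0 dom]]]] := universal_state n.+1 h0.
  exists W, q, K; split=> //.
  (* The dominating state commutes with every tensor power, in particular with [s n] and with the
     representation; [s n] commutes with the representation by invariance. *)
  exists (bicommutant2 (s n) (spec W q)).
    apply: (@bicommutant2_abelian _ _ _ _ _ G (fun g => tpow (u g) n.+1)) => //.
    - exact: (hs n).1.
    - exact: adjmx_spec.
    - exact: com.
    - by move=> g; rewrite As.
  by split=> Y YS YT.
(* Without support inclusion, both sequences are constantly infinite. *)
have [hsupp|nsupp] := pselect (supp_le rho0 rho1); last first.
  have nn n : ~ supp_le (r n) (s n) by move/(tpow_supp_leI h0 h1.1).
  rewrite relent_pinfty //; split.
    apply: cvg_near_cst; apply: nearW => n.
    rewrite twE relent_restr_pinfty //; try exact: hr; try exact: hs.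
    by rewrite gt0_muley // lte_fin invr_gt0 ltr0n.
  apply: cvg_near_cst; apply: nearW => n.
  have [W [q [K [_ _ _ _ [B hB [Bs _]]]]]] := univ n.
  (* The supremum is already infinite at the bicommutant [B], which contains [s n]. *)
  rewrite (_ : ereal_sup _ = +oo%E) ?gt0_muley ?lte_fin ?invr_gt0 ?ltr0n //.
  apply/eqP; rewrite -leye_eq; apply: ereal_sup_ubound; exists B => //.
  by rewrite reE //; have [hB' _ _] := hB; exact: (relent_restr_pinfty hB' (hr n) (hs n) Bs (nn n)).
rewrite relentE //.
have [eps [eps0 heps]] := ln_poly_small R (d * d).
have hrs n := tpow_relent n.+1 h0 h1.1 hsupp.
(* One domination factor [K] serves both limits: on the commutant for the first, on the abelian
   algebra [B] for the second. *)
split; apply: (squeeze_rate eps0) => n;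
  have [W [q [K [[hW hq tr1] com Kb dom [B hB [Bs BT]]]]]] := univ n;
  exists K; have /andP[K0 _] := Kb; have [hsn etr] := hrs n;
  (split; first exact: heps); rewrite -etr.
- rewrite twE; exact (relent_restr_ge (hA n.+1) (hr n) (hs n) hsn (As n) com hW hq tr1 K0 dom).
- rewrite twE; exact (relent_restr_le (hA n.+1) (hr n) (hs n) hsn).
- apply: (@le_trans _ _ (relent_restr B (r n) (s n))).
    have [hB' _ _] := hB.
    exact (relent_restr_ge hB' (hr n) (hs n) hsn Bs BT hW hq tr1 K0 dom).
  by apply: ereal_sup_ubound; exists B; [exact hB|exact (reE n B hB)].
(* Monotonicity bounds every abelian subalgebra, hence the supremum. *)
apply: ge_ereal_sup => _ [B' hB' <-]; rewrite (reE n B' hB').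
have [hB'' _ _] := hB'; exact (relent_restr_le hB'' (hr n) (hs n) hsn).
Qed.
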